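(* Let $B:[0,T]\to\mathrm{Sym}(2n)$ be continuous, $\psi$ the fundamental solution of $z'=J_0B(t)z$ with $\psi(0)=\mathrm{Id}$, $L,L_1,L_2\in\Lambda(n)$ and $\ell(t)=\psi(t)L$. Assume that $\ell$ is an $L_1$-plus curve and an $L_2$-plus curve. For $i=1,2$ let $\nu(L_i,[0,T])=\sum_{t\in[0,T]}\dim(\ell(t)\cap L_i)$ (finite sum). Let $$e_i=\dim(L\cap\ell(T))-\dim(L\cap\ell(T)\cap L_i)\ (i=1,2),\quad \delta_1=L\cap L_1+L_1\cap L_2,\quad \delta_2=\ell(T)\cap L_2+L_1\cap L_2,$$ $k_1=\min\{e_1,e_2\}$, $k_2=\min\{\dim\delta_1,\dim\delta_2\}$, $k=\max\{k_1,k_2\}$. Then $$\big|\nu(L_2,[0,T])-\nu(L_1,[0,T])\big|\le n-k.$$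
   Context: The standard symplectic space is $\mathbb R^{2n}=\mathbb R^n\oplus\mathbb R^n$ with coordinates $z=(p,q)$, $\omega_0((p_1,q_1),(p_2,q_2))=\langle p_1,q_2\rangle-\langle q_1,p_2\rangle$, $J_0(p,q)=(-q,p)$; $\Lambda(n)$ is its Lagrangian Grassmannian and $\mathrm{Sym}(2n)$ the symmetric $2n\times2n$ matrices. For $L_0\in\Lambda(n)$ and a $\mathscr C^1$ path $\ell$ in $\Lambda(n)$, a crossing is an instant $t_0$ with $\ell(t_0)\cap L_0\ne\{0\}$; the crossing form on $\ell(t_0)\cap L_0$ is $\Gamma(\ell,L_0,t_0)[v]=\frac{d}{dt}|_{t=t_0}\omega_0(v,w(t))$, where $W$ is a fixed Lagrangian transversal to $\ell(t_0)$ and $w(t)\in W$ is the unique vector with $v+w(t)\in\ell(t)$. The curve $\ell$ is an $L_0$-plus curve if at every crossing instant the crossing form is positive definite. *)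

(* Defs.v *)
From HB Require Import structures.
From mathcomp Require Import all_boot all_order all_algebra.
From mathcomp Require Import all_classical all_reals all_analysis.
Set Implicit Arguments. Unset Strict Implicit. Unset Printing Implicit Defensive.
Import Order.TTheory GRing.Theory Num.Theory.
Import numFieldNormedType.Exports.
Local Open Scope classical_set_scope.
Local Open Scope ring_scope.

Section Symplectic.
Variables (R : realType) (n : nat).

(* R^{2n} = R^n (+) R^n, column vectors z = (p, q):
   p = first n coordinates, q = last n coordinates. *)
Notation vec := 'cV[R]_(n + n).

Definition omega0 (z1 z2 : vec) : R :=
  \sum_(i < n) (z1 (lshift n i) 0 * z2 (rshift n i) 0
                - z1 (rshift n i) 0 * z2 (lshift n i) 0).

Definition J0 : 'M[R]_(n + n) := block_mx 0 (- 1%:M) 1%:M 0.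

Definition lagrangian (L : {vspace vec}) : Prop :=
  \dim L = n /\ {in L &, forall u v, omega0 u v = 0}.

Definition mx_img (A : 'M[R]_(n + n)) (L : {vspace vec}) : {vspace vec} :=
  (linfun (mulmx A) @: L)%VS.
End Symplectic.

Definition deriv_within {R : realType} {V : normedModType R}
  (a b : R) (f : R -> V) (t0 : R) (d : V) : Prop :=
  (fun t => (t - t0)^-1 *: (f t - f t0))
    @ within [set t | t != t0 /\ a <= t <= b] (nbhs t0) --> d.

Section Crossing.
Variables (R : realType) (n : nat) (T : R).
Notation vec := 'cV[R]_(n + n).

(* c is the value Gamma(ell, L0, t0)[v] of the crossing form, computed with
   the Lagrangian transversal W to ell(t0): w(t) in W with v + w(t) in ell(t)
   for t in [0,T] near t0, and c = d/dt|_{t0} w0(v, w(t)). *)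
Definition crossing_form_value (ell : R -> {vspace vec}) (t0 : R)
  (W : {vspace vec}) (v : vec) (c : R) : Prop :=
  exists w : R -> vec,
    within [set t | 0 <= t <= T] (nbhs t0)
      [set t | w t \in W /\ v + w t \in ell t]
    /\ deriv_within 0 T (fun t => omega0 v (w t)) t0 c.

Definition crossing (ell : R -> {vspace vec}) (L0 : {vspace vec}) (t0 : R) :=
  0 <= t0 <= T /\ (ell t0 :&: L0)%VS != 0%VS.

Definition plus_curve (ell : R -> {vspace vec}) (L0 : {vspace vec}) : Prop :=
  forall t0, crossing ell L0 t0 ->
  forall W, lagrangian W -> (ell t0 :&: W)%VS = 0%VS ->
  forall v, v \in (ell t0 :&: L0)%VS -> v != 0 ->
  exists2 c, crossing_form_value ell t0 W v c & 0 < c.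

Definition nu (ell : R -> {vspace vec}) (L0 : {vspace vec}) : int :=
  (\sum_(t \in `[0, T]) (\dim (ell t :&: L0)%VS)%:Z)%R.
End Crossing.

(* Main.v *)
Require Import Defs.
From HB Require Import structures.
From mathcomp Require Import all_boot all_order all_algebra.
From mathcomp Require Import all_classical all_reals all_analysis.
From mathcomp Require Import ring lra zify.
Set Implicit Arguments. Unset Strict Implicit. Unset Printing Implicit Defensive.
Import Order.TTheory GRing.Theory Num.Theory.
Import numFieldNormedType.Exports.
Local Open Scope classical_set_scope.
Local Open Scope ring_scope.

(** Let [Q t] be Kashiwara's quadratic form
    [w(x1,x2) + w(x2,x3) + w(x3,x1)] on [L1 x L2 x ell t], and [x_i t] the
    dimension of [ell t :&: L_i]. Its kernel is the direct sum of
    [ell t :&: L1], [ell t :&: L2] and [L1 :&: L2], and on these summands the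
    time derivative of [Q] is minus the crossing form, the crossing form and
    zero. Since the third summand is always in the kernel, the positive index
    [p] of [Q] satisfies, near any [t0], [p t = p t0 + x_2 t0] on the right and
    [p t = p t0 + x_1 t0] on the left; moreover the crossings are isolated.
    Summing the jumps over [0, T],
    [nu L2 - nu L1 = p T - p 0 + x_2 T - x_1 0].
    The two indices on the right are estimated by isotropic subspaces: the
    factor [L1] of [L1 x L2 x ell t] gives the bound by [k2], and the diagonal
    [L1 x L2 x (L :&: ell T)] in the difference of [Q 0] and [Q T] gives the
    bound by [k1]. *)

(** * Inertia of symmetric matrices *)

(** Only one derivative at each instant is available, so no eigenvalue is followed in time. Indices
    are sizes of frames [P] with [P Q P^T = 1]. Such frames survive small perturbations, but this
    bounds the positive and the negative index of [Q t] from below only. The bound from above is the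
    rank: it never exceeds [3n - dim (L1 :&: L2)], and near [t0] the two lower bounds already add up
    to this number. So both are attained and no crossing is left close to [t0]. The degeneracy along
    [L1 :&: L2], where the derivative gives no information, is thereby harmless: it costs the same
    rank at all times. The endpoint terms [x_2 T] and [x_1 0] appear because one side of the jump at
    0 and at T falls outside the interval. The minima in [k1] and [k2] come from the absolute value:
    [nu L2 - nu L1] and its opposite are bounded by different members of each pair. *)

Section Inertia.
Variable R : rcfType.

Lemma mulmx_tr_eq0 m N (A : 'M[R]_(m, N)) : A *m A^T = 0 -> A = 0.
Proof.
move=> A0; apply/matrixP => i j; rewrite mxE.
have : (A *m A^T) i i = 0 by rewrite A0 mxE.
rewrite mxE => /eqP; rewrite psumr_eq0; last by move=> k _; rewrite mxE -expr2 sqr_ge0.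
by move=> /allP/(_ j); rewrite mem_index_enum mxE mulf_eq0 orbb => /(_ isT)/eqP.
Qed.

Lemma sym_form_eq0 N (A : 'M[R]_N) :
  A^T = A -> (forall x : 'rV[R]_N, x *m A *m x^T = 0) -> A = 0.
Proof.
move=> As A0; apply/matrixP => i j; rewrite mxE.
have E k l : (delta_mx 0 k : 'rV[R]_N) *m A *m (delta_mx 0 l)^T = (A k l)%:M.
  rewrite -rowE trmx_delta -colE; apply/matrixP => a b.
  by rewrite !ord1 !mxE eqxx mulr1n.
have := A0 (delta_mx 0 i + delta_mx 0 j).
rewrite linearD /= mulmxDl mulmxDr !mulmxDl !A0 add0r addr0 !E -raddfD /=.
move/matrixP/(_ 0 0); rewrite !mxE eqxx mulr1n.
have -> : A j i = A i j by rewrite -{1}As mxE.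
by move=> /eqP; rewrite -mulr2n mulrn_eq0 => /eqP.
Qed.

Lemma form_tr m p N (Q : 'M[R]_N) (A : 'M[R]_(m, N)) (B : 'M[R]_(p, N)) :
  Q^T = Q -> (A *m Q *m B^T)^T = B *m Q *m A^T.
Proof. by move=> Qs; rewrite !trmx_mul trmxK Qs mulmxA. Qed.

(** A frame with Gram matrix 1 is automatically independent modulo the kernel of [Q]. The negative
    index is read off [- Q]. *)
Definition has_pos N (Q : 'M[R]_N) p :=
  exists P : 'M[R]_(p, N), P *m Q *m P^T = 1%:M.

Lemma has_pos_bound N (Q : 'M[R]_N) p : has_pos Q p -> (p <= N)%N.
Proof.
case=> P PQ; rewrite -(mxrank1 R p) -PQ -mulmxA.
by rewrite (leq_trans (mxrankM_maxl _ _)) // rank_leq_col.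
Qed.

Lemma has_pos0 N (Q : 'M[R]_N) : has_pos Q 0.
Proof. by exists 0; apply/matrixP => -[]. Qed.

(** The two frames need not be orthogonal: if [(a P + b M) Q = 0], pairing with [P] and [M] gives
    [a = - b S^T] and [b = a S], hence [a a^T = - b b^T] and both vanish. So the joint frame stays
    independent after multiplication by [Q]. *)
Lemma has_pos_sum_rank N (Q : 'M[R]_N) p m :
  Q^T = Q -> has_pos Q p -> has_pos (- Q) m -> (p + m <= \rank Q)%N.
Proof.
move=> Qs [P PQ] [M MQ].
have MQ' : M *m Q *m M^T = - 1%:M by rewrite -MQ mulmxN mulNmx opprK.
suff /eqP <- : row_free (col_mx P M *m Q) by exact: mxrankM_maxr.
apply: inj_row_free => v; rewrite -[v]hsubmxK mulmxA mul_row_col.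
set a := lsubmx v; set b := rsubmx v => ab0.
pose S := P *m Q *m M^T.
have St : M *m Q *m P^T = S^T by rewrite /S !trmx_mul Qs trmxK mulmxA.
have eP : a + b *m S^T = 0.
  by rewrite -[RHS](mul0mx _ P^T) -ab0 -St !mulmxDl !mulmxA -(mulmxA a) -(mulmxA a)
    PQ mulmx1.
have eM : a *m S - b = 0.
  rewrite -[RHS](mul0mx _ M^T) -ab0 !mulmxDl /S !mulmxA; congr (_ + _).
  by rewrite -(mulmxA b) -(mulmxA b) MQ' mulmxN mulmx1.
have a_eq : a = - (b *m S^T) by apply/eqP; rewrite -addr_eq0; apply/eqP.
have b_eq : b = a *m S by apply/esym/eqP; rewrite -subr_eq0; apply/eqP.
suff b0 : b = 0 by rewrite a_eq b0 mul0mx oppr0 row_mx0.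
have a0 : a = 0; last by rewrite b_eq a0 mul0mx.
apply: mulmx_tr_eq0; apply/matrixP => i j; rewrite !ord1.
have h : a *m a^T + b *m b^T = 0.
  have -> : b^T = S^T *m a^T by rewrite {1}b_eq trmx_mul.
  by rewrite {1}a_eq mulNmx mulmxA addNr.
have sq k (c : 'rV[R]_k) : 0 <= (c *m c^T) 0 0.
  by rewrite mxE sumr_ge0 // => l _; rewrite mxE -expr2 sqr_ge0.
have /matrixP/(_ 0 0) := h; rewrite mxE [X in _ = X]mxE => /eqP.
by rewrite paddr_eq0 ?sq // => /andP[/eqP-> _]; rewrite mxE.
Qed.

Lemma normalize_form N (Q : 'M[R]_N) (w : 'rV[R]_N) (c : R) :
  0 < c -> w *m Q *m w^T = c%:M ->
  let w' := (Num.sqrt c)^-1 *: w in w' *m Q *m w'^T = 1%:M.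
Proof.
move=> c0 wQ /=; rewrite !linearZ /= -!scalemxAl wQ !scale_scalar_mx.
rewrite mulrA -invrM ?unitfE ?sqrtr_eq0 -?ltNge //.
by rewrite -expr2 sqr_sqrtr ?ltW // mulVf // gt_eqF.
Qed.

Lemma col_mx_form p q N (Q : 'M[R]_N) (P : 'M[R]_(p, N)) (M : 'M[R]_(q, N)) :
  col_mx P M *m Q *m (col_mx P M)^T =
  block_mx (P *m Q *m P^T) (P *m Q *m M^T) (M *m Q *m P^T) (M *m Q *m M^T).
Proof. by rewrite mul_col_mx tr_col_mx mul_col_row. Qed.

(* Extends a Q-orthogonal pair of a positive and a negative frame until it
   exhausts the rank. *)
Lemma inertia_step N (Q : 'M[R]_N) k : Q^T = Q ->
  forall p m (P : 'M[R]_(p, N)) (M : 'M[R]_(m, N)),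
  P *m Q *m P^T = 1%:M -> M *m Q *m M^T = - 1%:M -> P *m Q *m M^T = 0 ->
  (\rank Q <= p + m + k)%N ->
  exists p' m', [/\ has_pos Q p', has_pos (- Q) m' & (\rank Q <= p' + m')%N].
Proof.
move=> Qs; elim: k => [|k IH] p m P M PP MM PM rk.
  exists p, m; split; [by exists P| |by rewrite addn0 in rk].
  by exists M; rewrite mulmxN mulNmx MM opprK.
have MP : M *m Q *m P^T = 0.
  by rewrite -[LHS]trmxK form_tr // PM trmx0.
(* The [Q]-orthogonal projection of row vectors onto the span of [P] and [M]; the minus sign
   compensates [M Q M^T = -1]. *)
pose Pi := Q *m P^T *m P - Q *m M^T *m M.
pose E := 1%:M - Pi.
have EP : E *m Q *m P^T = 0.
  rewrite /E /Pi !mulmxBl mul1mx -!mulmxA (mulmxA P) (mulmxA M) PP MP.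
  by rewrite !mulmx0 mulmx1 subr0 subrr.
have EM : E *m Q *m M^T = 0.
  rewrite /E /Pi !mulmxBl mul1mx -!mulmxA (mulmxA P) (mulmxA M) PM MM.
  by rewrite !mulmx0 mulmxN mulmx1 sub0r mulmxN opprK subrr.
(* If the form vanishes on the complement [E], then [Q = Pi Q] and the frames already exhaust the
   rank. Otherwise some vector of the complement has a nonzero value, whose sign decides which frame
   it extends. *)
have [A0|/eqP A0] := eqVneq (E *m Q *m E^T) 0.
  exists p, m; split; [by exists P | by exists M; rewrite mulmxN mulNmx MM opprK |].
  have EQ : E *m Q = 0.
    rewrite -[LHS]mulmx1 -(trmx1 R N) -(subrK Pi 1%:M) -/E linearD /= mulmxDr A0 add0r.
    by rewrite /Pi linearB /= !trmx_mul !trmxK Qs mulmxBr !mulmxA EP EM !mul0mx subr0.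
  have -> : Q = Pi *m Q.
    by apply/eqP; rewrite -subr_eq0 -{1}(mul1mx Q) -mulmxBl; apply/eqP.
  apply: leq_trans (mxrankM_maxl _ _) _.
  apply: leq_trans (mxrank_add _ _) _; rewrite mxrank_opp; apply: leq_add.
    by apply: leq_trans (mxrankM_maxr _ _) (rank_leq_row _).
  by apply: leq_trans (mxrankM_maxr _ _) (rank_leq_row _).
have [x xA] : exists x : 'rV[R]_N, (x *m (E *m Q *m E^T) *m x^T) 0 0 != 0.
  apply: contrapT => nx; apply: A0; apply: sym_form_eq0.
    by rewrite !trmx_mul trmxK Qs mulmxA.
  move=> x; apply/matrixP => i j; rewrite !ord1 [RHS]mxE.
  by apply/eqP; apply: contrapT => h; apply: nx; exists x; apply/negP.
pose w := x *m E.
have wc : w *m Q *m w^T = ((w *m Q *m w^T) 0 0)%:M by rewrite -mx11_scalar.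
have wP : w *m Q *m P^T = 0 by rewrite /w -!mulmxA (mulmxA E) EP mulmx0.
have wM : w *m Q *m M^T = 0 by rewrite /w -!mulmxA (mulmxA E) EM mulmx0.
have Pw : P *m Q *m w^T = 0.
  by rewrite -[LHS]trmxK form_tr // wP trmx0.
have Mw : M *m Q *m w^T = 0.
  by rewrite -[LHS]trmxK form_tr // wM trmx0.
have : (w *m Q *m w^T) 0 0 != 0 by rewrite /w trmx_mul !mulmxA in xA *.
move: wc; set c := (_ 0 0) => wc; rewrite neq_lt => /orP[c0|c0].
  have := @normalize_form N (- Q) w (- c); rewrite oppr_gt0 => /(_ c0).
  rewrite mulmxN mulNmx wc -raddfN => /(_ erefl) /=; set w' := _ *: w => w'Q.
  apply: (IH p (m + 1)%N P (col_mx M w')) => //; last first.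
  - by move: rk; lia.
  - rewrite tr_col_mx mul_mx_row PM.
    by rewrite /w' !linearZ /= Pw scaler0 row_mx0.
  rewrite col_mx_form MM scalar_mx_block opp_block_mx !oppr0; congr block_mx => //.
  - by rewrite /w' !linearZ /= Mw scaler0.
  - by rewrite /w' -!scalemxAl wM scaler0.
  - by rewrite -w'Q mulmxN mulNmx opprK.
have := normalize_form c0 wc => /=; set w' := _ *: w => w'Q.
apply: (IH (p + 1)%N m (col_mx P w') M) => //; last first.
- by move: rk; lia.
- by rewrite !mul_col_mx PM /w' -!scalemxAl wM scaler0 col_mx0.
rewrite col_mx_form PP scalar_mx_block; congr block_mx => //.
- by rewrite /w' !linearZ /= Pw scaler0.
- by rewrite /w' -!scalemxAl wP scaler0.
Qed.

Lemma inertia_exists N (Q : 'M[R]_N) : Q^T = Q ->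
  exists p m, [/\ has_pos Q p, has_pos (- Q) m & (\rank Q <= p + m)%N].
Proof.
move=> Qs; apply: (@inertia_step N Q (\rank Q) Qs 0 0 0 0) => //.
- by apply/matrixP => -[].
- by apply/matrixP => -[].
- by apply/matrixP => -[].
Qed.

Fact has_pos_exists N (Q : 'M[R]_N) : exists p, `[< has_pos Q p >].
Proof. by exists 0%N; apply/asboolP; exact: has_pos0. Qed.

Fact has_pos_max N (Q : 'M[R]_N) p : `[< has_pos Q p >] -> (p <= N)%N.
Proof. by move=> /asboolP; exact: has_pos_bound. Qed.

Definition posix N (Q : 'M[R]_N) : nat :=
  ex_maxn (has_pos_exists Q) (@has_pos_max N Q).

Lemma posixP N (Q : 'M[R]_N) : has_pos Q (posix Q).
Proof. by rewrite /posix; case: ex_maxnP => p /asboolP. Qed.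

Lemma posix_geq N (Q : 'M[R]_N) p : has_pos Q p -> (p <= posix Q)%N.
Proof. by rewrite /posix; case: ex_maxnP => q _ qm /asboolP; exact: qm. Qed.

(** Sylvester's law of inertia: one inequality holds for any two frames, the other because some pair
    exhausts the rank. *)
Lemma posix_rank N (Q : 'M[R]_N) :
  Q^T = Q -> (posix Q + posix (- Q) = \rank Q)%N.
Proof.
move=> Qs; apply/eqP; rewrite eqn_leq has_pos_sum_rank //=; try exact: posixP.
have [p [m [Pp Pm]]] := inertia_exists Qs.
by move=> /leq_trans; apply; rewrite leq_add // posix_geq.
Qed.

(** A row of a negative frame would contradict positivity, so the negative index is 0 and the
    positive one is the full rank. *)
Lemma posdef_frame N (M : 'M[R]_N) : M^T = M ->
  (forall x : 'rV[R]_N, x != 0 -> 0 < (x *m M *m x^T) 0 0) -> has_pos M N.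
Proof.
move=> Ms Mp; have rM : \rank M = N.
  apply/eqP; apply: inj_row_free => v vM; apply: contrapT => /eqP/Mp.
  by rewrite vM mul0mx mxE ltxx.
have m0 : posix (- M) = 0%N.
  case: (posix (- M)) (posixP (- M)) => // m [P PM].
  pose x := row 0 P; have xM : (x *m M *m x^T) 0 0 = -1.
    have := PM; move/matrixP/(_ 0 0); rewrite mulmxN mulNmx !mxE eqxx mulr1n => <-.
    rewrite opprK; apply: eq_bigr => i _; rewrite !mxE; congr (_ * _).
    by apply: eq_bigr => j _; rewrite !mxE.
  have [x0|/Mp] := eqVneq x 0; last by rewrite xM oppr_gt0 ltr10.
  by move: xM; rewrite x0 !mul0mx mxE => /eqP; rewrite eq_sym oppr_eq0 oner_eq0.
by have := posix_rank Ms; rewrite m0 addn0 rM => p_eq;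
  rewrite -[X in has_pos _ X]p_eq; exact: posixP.
Qed.

(* An isotropic frame V with V Q of full row rank has a dual frame W, and
   W - S V / 2 is a dual frame that is isotropic too: adding V / 2 to it gives
   an orthonormal frame. *)
Lemma isotropic_has_pos m N (Q : 'M[R]_N) (U : 'M[R]_(m, N)) :
  Q^T = Q -> U *m Q *m U^T = 0 -> has_pos Q (\rank (U *m Q)).
Proof.
move=> Qs UU; have /submxP[C CE] : (row_base (U *m Q) <= U *m Q)%MS.
  by rewrite eq_row_base.
pose V := C *m U.
have VV : V *m Q *m V^T = 0.
  by rewrite /V trmx_mul -!mulmxA (mulmxA U Q) (mulmxA (U *m Q)) UU mul0mx mulmx0.
have /row_freeP[W VW] : row_free (V *m Q).
  by rewrite /V -mulmxA -CE row_base_free.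
pose S := W^T *m Q *m W.
have Ss : S^T = S by rewrite /S !trmx_mul trmxK Qs mulmxA.
have WV : W^T *m Q *m V^T = 1%:M.
  by rewrite -[LHS]trmxK form_tr // trmxK VW trmx1.
pose D : 'M[R]_(\rank (U *m Q)) := 2^-1 *: (1%:M - S).
have Ds : D^T = D by rewrite /D linearZ linearB /= trmx1 Ss.
exists (D *m V + W^T).
rewrite linearD /= trmx_mul trmxK Ds.
have -> : (D *m V + W^T) *m Q *m (V^T *m D + W) =
  D *m (V *m Q *m V^T) *m D + D *m (V *m Q *m W) + ((W^T *m Q *m V^T) *m D + S).
  by rewrite /S !(mulmxDl, mulmxDr) !mulmxA; apply/matrixP => i j; rewrite !mxE; ring.
rewrite VV VW WV mulmx0 mul0mx add0r mulmx1 mul1mx addrA /D -scalerDl.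
have -> : (2^-1 + 2^-1 : R) = 1 by lra.
by rewrite scale1r subrK.
Qed.

End Inertia.

(** * Kashiwara form of three Lagrangian subspaces *)

Section Kashiwara.
Variables (R : rcfType) (n : nat) (Om : 'M[R]_(n + n)).
Hypotheses (Oms : Om^T = - Om) (Omu : Om \in unitmx).

Definition lagr_mx (M : 'M[R]_(n, n + n)) := row_free M /\ M *m Om *m M^T = 0.

(** A Lagrangian is its own symplectic orthogonal: it is contained in it, and both have dimension
    [n]. *)
Lemma lagr_mxP m (M : 'M[R]_(n, n + n)) (x : 'M[R]_(m, n + n)) :
  lagr_mx M -> x *m Om *m M^T = 0 -> (x <= M)%MS.
Proof.
move=> [Mf MM] xM.
have Mk : (M <= kermx (Om *m M^T))%MS by apply/sub_kermxP; rewrite mulmxA.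
have xk : (x <= kermx (Om *m M^T))%MS by apply/sub_kermxP; rewrite mulmxA.
apply: (submx_trans xk); rewrite -(mxrank_leqif_sup Mk).2 mxrank_ker.
rewrite eqmxMfull; last by rewrite row_full_unit.
by rewrite mxrank_tr (eqP Mf) addnK.
Qed.

Lemma skew_tr m p (A : 'M[R]_(m, n + n)) (B : 'M[R]_(p, n + n)) :
  (A *m Om *m B^T)^T = - (B *m Om *m A^T).
Proof. by rewrite !trmx_mul trmxK Oms mulNmx mulmxN mulmxA. Qed.

(* The matrix of Kashiwara's form w(x1,x2) + w(x2,x3) + w(x3,x1) (times 2) on
   the row spaces of M1, M2 and X. *)
Definition kash e (M1 M2 : 'M[R]_(n, n + n)) (X : 'M[R]_(e, n + n)) :
    'M[R]_(n + (n + e)) :=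
  block_mx 0 (row_mx (M1 *m Om *m M2^T) (- (M1 *m Om *m X^T)))
    (col_mx (- (M2 *m Om *m M1^T)) (X *m Om *m M1^T))
    (block_mx 0 (M2 *m Om *m X^T) (- (X *m Om *m M2^T)) 0).

Lemma kash_sym e M1 M2 (X : 'M[R]_(e, n + n)) : (kash M1 M2 X)^T = kash M1 M2 X.
Proof.
rewrite /kash !(tr_block_mx, tr_row_mx, tr_col_mx) !trmx0.
by rewrite !(raddfN, skew_tr) /= !skew_tr ?opprK.
Qed.

(** Gives the kernel equations: [x3 - x2], [x1 - x3] and [x2 - x1] are orthogonal to [M1], [M2] and
    [X], hence lie in them when these are Lagrangian. *)
Lemma mul_kash m e (A B : 'M[R]_(m, n)) (C : 'M[R]_(m, e)) M1 M2 (X : 'M[R]_(e, n + n)) :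
  row_mx A (row_mx B C) *m kash M1 M2 X =
  row_mx ((C *m X - B *m M2) *m Om *m M1^T)
    (row_mx ((A *m M1 - C *m X) *m Om *m M2^T) ((B *m M2 - A *m M1) *m Om *m X^T)).
Proof.
rewrite /kash mul_row_block mulmx0 add0r mul_row_col mul_mx_row mul_row_block.
rewrite !mulmx0 add0r addr0 add_row_mx !mulmxN !mulmxBl !mulmxA.
by rewrite addrC [X in row_mx _ (row_mx _ X)]addrC.
Qed.

Lemma kash_form m e (A B : 'M[R]_(m, n)) (C : 'M[R]_(m, e)) M1 M2 (X : 'M[R]_(e, n + n))
    m' (A' B' : 'M[R]_(m', n)) (C' : 'M[R]_(m', e)) :
  row_mx A (row_mx B C) *m kash M1 M2 X *m (row_mx A' (row_mx B' C'))^T =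
  (C *m X - B *m M2) *m Om *m (A' *m M1)^T
  + ((A *m M1 - C *m X) *m Om *m (B' *m M2)^T
  + (B *m M2 - A *m M1) *m Om *m (C' *m X)^T).
Proof. by rewrite mul_kash !tr_row_mx !mul_row_col !trmx_mul !mulmxA. Qed.

Lemma row_mx3K m e (A : 'M[R]_(m, n + (n + e))) :
  A = row_mx (lsubmx A) (row_mx (lsubmx (rsubmx A)) (rsubmx (rsubmx A))).
Proof. by rewrite !hsubmxK. Qed.

(* On the kernel of the Kashiwara form, (x1,x2,x3) is determined by
   2 v1 = x1 - x2 + x3, 2 v2 = x2 - x1 + x3 and 2 u = x1 + x2 - x3. *)
Lemma rank_triple m e m1 m2 m3 (A B : 'M[R]_(m, n)) (C : 'M[R]_(m, e)) M1 M2
    (X : 'M[R]_(e, n + n)) (C1 : 'M[R]_(m1, n + n)) (C2 : 'M[R]_(m2, n + n))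
    (C3 : 'M[R]_(m3, n + n)) :
  row_free M1 -> row_free M2 -> row_free X ->
  ((A *m M1 - B *m M2 + C *m X)%R <= C1)%MS ->
  ((B *m M2 - A *m M1 + C *m X)%R <= C2)%MS ->
  ((A *m M1 + B *m M2 - C *m X)%R <= C3)%MS ->
  (\rank (row_mx A (row_mx B C)) <= \rank C1 + \rank C2 + \rank C3)%N.
Proof.
move=> /row_freeP[Z1 Z1E] /row_freeP[Z2 Z2E] /row_freeP[Z3 Z3E].
move=> h1 h2 h3; pose V1 := A *m M1 - B *m M2 + C *m X.
pose V2 := B *m M2 - A *m M1 + C *m X; pose V3 := A *m M1 + B *m M2 - C *m X.
have half m' n' (Y : 'M[R]_(m', n')) : 2^-1 *: (Y + Y) = Y.
  by apply/matrixP => i j; rewrite !mxE; field.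
have AE : A = 2^-1 *: (V1 + V3) *m Z1.
  rewrite (_ : V1 + V3 = A *m M1 + A *m M1) ?half -?mulmxA ?Z1E ?mulmx1 //.
  by apply/matrixP => i j; rewrite !mxE; ring.
have BE : B = 2^-1 *: (V2 + V3) *m Z2.
  rewrite (_ : V2 + V3 = B *m M2 + B *m M2) ?half -?mulmxA ?Z2E ?mulmx1 //.
  by apply/matrixP => i j; rewrite !mxE; ring.
have CE : C = 2^-1 *: (V1 + V2) *m Z3.
  rewrite (_ : V1 + V2 = C *m X + C *m X) ?half -?mulmxA ?Z3E ?mulmx1 //.
  by apply/matrixP => i j; rewrite !mxE; ring.
have -> : row_mx A (row_mx B C) =
  V1 *m (2^-1 *: row_mx Z1 (row_mx 0 Z3)) + V2 *m (2^-1 *: row_mx 0 (row_mx Z2 Z3))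
  + V3 *m (2^-1 *: row_mx Z1 (row_mx Z2 0)).
  rewrite -!scalemxAr -!scalerDr !mul_mx_row !mulmx0 !add_row_mx !addr0 !add0r.
  rewrite !scale_row_mx {1}AE {1}BE {1}CE -!mulmxDl.
  by rewrite -!scalemxAl.
apply: leq_trans (mxrank_add _ _) (leq_add _ _); last first.
  by apply: leq_trans (mxrankM_maxl _ _) _; exact: mxrankS.
apply: leq_trans (mxrank_add _ _) (leq_add _ _).
  by apply: leq_trans (mxrankM_maxl _ _) _; exact: mxrankS.
by apply: leq_trans (mxrankM_maxl _ _) _; exact: mxrankS.
Qed.

Section Triple.
Variables M1 M2 : 'M[R]_(n, n + n).
Hypotheses (l1 : lagr_mx M1) (l2 : lagr_mx M2).

(** By the kernel equations each of the three combinations in [rank_triple] lies in two of the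
    Lagrangians at once. For instance [x1 - x2 + x3] is in [M1] since [x3 - x2] is, and in [X] since
    [x1 - x2] is. *)
Lemma rank_kash_geq X : lagr_mx X ->
  (n + (n + n) <= \rank (kash M1 M2 X) + \rank (X :&: M1)%MS + \rank (X :&: M2)%MS
    + \rank (M1 :&: M2)%MS)%N.
Proof.
move=> lX; set Q := kash _ _ _.
suff: (\rank (kermx Q) <=
    \rank (X :&: M1)%MS + \rank (X :&: M2)%MS + \rank (M1 :&: M2)%MS)%N.
  by rewrite mxrank_ker; have := rank_leq_row Q; lia.
have := mulmx_ker Q; rewrite (row_mx3K (kermx Q)).
move: (lsubmx _) (lsubmx (rsubmx _)) (rsubmx (rsubmx _)) => A B C.
rewrite mul_kash -[RHS]row_mx0 -[X in _ = row_mx _ X]row_mx0.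
case/eq_row_mx => /(lagr_mxP l1) h1 /eq_row_mx[/(lagr_mxP l2) h2 /(lagr_mxP lX) h3].
apply: (rank_triple l1.1 l2.1 lX.1); rewrite sub_capmx; apply/andP; split.
- by rewrite addmx_sub ?submxMl // -opprB eqmx_opp.
- by rewrite -addrA [- _ + _]addrC addmx_sub ?submxMl.
- by rewrite addmx_sub ?submxMl.
- by rewrite -addrA addmx_sub ?submxMl // addrC -opprB eqmx_opp.
- by rewrite -addrA addmx_sub ?submxMl // -opprB eqmx_opp.
- by rewrite [X in X - _]addrC -addrA addmx_sub ?submxMl.
Qed.

(** The Kashiwara matrix acts on coordinates, so a vector of an intersection enters through its
    coordinates in both frames. *)
Lemma capmx_frame m1 m2 (A : 'M[R]_(m1, n + n)) (B : 'M[R]_(m2, n + n)) :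
  exists (al : 'M[R]_(\rank (A :&: B)%MS, m1)) (be : 'M[R]_(\rank (A :&: B)%MS, m2)),
    al *m A = be *m B /\ row_free (al *m A) /\ (al *m A :=: A :&: B)%MS.
Proof.
have [/submxP[al alE] /submxP[be beE]] :
    (row_base (A :&: B)%MS <= A)%MS /\ (row_base (A :&: B)%MS <= B)%MS.
  by rewrite !eq_row_base capmxSl capmxSr.
by exists al, be; rewrite -alE -beE row_base_free; split => //; split => //;
  exact: eq_row_base.
Qed.

(** The kernel contains the triples [(v, 0, v)], [(0, v, v)] and [(v, v, 0)] with [v] in [X :&: M1],
    [X :&: M2] and [M1 :&: M2], and these three families are independent. *)
Lemma rank_kash_leq X : lagr_mx X ->
  (\rank (kash M1 M2 X) + \rank (X :&: M1)%MS + \rank (X :&: M2)%MS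
    + \rank (M1 :&: M2)%MS <= n + (n + n))%N.
Proof.
move=> lX; set Q := kash _ _ _.
have [g1 [a1 [E1 [F1 _]]]] := capmx_frame X M1.
have [g2 [b2 [E2 [F2 _]]]] := capmx_frame X M2.
have [a3 [b3 [E3 [F3 _]]]] := capmx_frame M1 M2.
pose N := col_mx (row_mx a1 (row_mx 0 g1))
  (col_mx (row_mx 0 (row_mx b2 g2)) (row_mx a3 (row_mx b3 0))).
have iso m (P : 'M[R]_(m, n)) M : lagr_mx M -> P *m M *m Om *m M^T = 0.
  by case=> _ MM; rewrite -!mulmxA (mulmxA M) MM mulmx0.
have NQ : N *m Q = 0.
  rewrite !mul_col_mx !mul_kash !mul0mx E1 E2 E3.
  have i1 : a1 *m M1 *m Om *m X^T = 0 by rewrite -E1 iso.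
  have i2 : b2 *m M2 *m Om *m X^T = 0 by rewrite -E2 iso.
  have i3 : b3 *m M2 *m Om *m M1^T = 0 by rewrite -E3 iso.
  rewrite !(subrr, subr0, sub0r, mulNmx, mul0mx).
  rewrite i1 i2 i3 !(iso _ _ _ l1) !(iso _ _ _ l2).
  by rewrite !(oppr0, row_mx0, col_mx0).
have Nf : row_free N.
  apply: inj_row_free => v.
  rewrite (_ : v = row_mx (lsubmx v) (row_mx (lsubmx (rsubmx v)) (rsubmx (rsubmx v))));
    last by rewrite !hsubmxK.
  move: (lsubmx v) (lsubmx (rsubmx v)) (rsubmx (rsubmx v)) => a b c.
  rewrite !mul_row_col !mul_mx_row !mulmx0 !add_row_mx !(add0r, addr0).
  rewrite -[RHS]row_mx0 -[X in _ = row_mx _ X]row_mx0.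
  case/eq_row_mx => /(congr1 (mulmx^~ M1)) h1.
  case/eq_row_mx => /(congr1 (mulmx^~ M2)) h2 /(congr1 (mulmx^~ X)) h3.
  move: h1 h2 h3; rewrite !mulmxDl !mul0mx -!mulmxA -E1 -E2 -E3 => h1 h2 h3.
  have z1 : a *m (g1 *m X) = 0.
    apply/matrixP => i j; move/matrixP/(_ i j): h1; move/matrixP/(_ i j): h2.
    by move/matrixP/(_ i j): h3; rewrite !mxE; lra.
  have z2 : b *m (g2 *m X) = 0.
    apply/matrixP => i j; move/matrixP/(_ i j): h1; move/matrixP/(_ i j): h2.
    by move/matrixP/(_ i j): h3; rewrite !mxE; lra.
  have z3 : c *m (a3 *m M1) = 0.
    apply/matrixP => i j; move/matrixP/(_ i j): h1; move/matrixP/(_ i j): h2.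
    by move/matrixP/(_ i j): h3; rewrite !mxE; lra.
  have -> : a = 0 by apply: (row_free_inj F1); rewrite mul0mx.
  have -> : b = 0 by apply: (row_free_inj F2); rewrite mul0mx.
  have -> : c = 0 by apply: (row_free_inj F3); rewrite mul0mx.
  by rewrite !row_mx0.
have /mxrankS : (N <= kermx Q)%MS by apply/sub_kermxP.
rewrite (eqP Nf) mxrank_ker; have := rank_leq_row Q.
move: (\rank Q) => r; lia.
Qed.

(** A triple [(x1, 0, 0)] is in the kernel of the form only if [x1] is orthogonal to, hence
    contained in, [M2] and [X]. The isotropic factor thus keeps rank at least [n] minus the triple
    intersection, and it yields as many positive as negative directions. *)
Lemma kash_isotropic X : lagr_mx X ->
  (n <= posix (kash M1 M2 X) + \rank (M1 :&: M2 :&: X)%MS)%N /\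
  (n <= posix (- kash M1 M2 X) + \rank (M1 :&: M2 :&: X)%MS)%N.
Proof.
move=> lX; set Q := kash _ _ _.
have Qs : Q^T = Q by exact: kash_sym.
pose U : 'M[R]_(n, n + (n + n)) := row_mx 1%:M (row_mx 0 0).
have UU : U *m Q *m U^T = 0.
  by rewrite kash_form !mul0mx subr0 mul1mx trmx0 !mulmx0 !mul0mx !addr0.
have rU : (n <= \rank (U *m Q) + \rank (M1 :&: M2 :&: X)%MS)%N.
  rewrite -leq_subLR -mxrank_ker -(mxrankMfree _ l1.1).
  set K := kermx _; have : K *m U *m Q = 0 by rewrite -mulmxA mulmx_ker.
  rewrite /U !mul_mx_row !mulmx0 mulmx1 mul_kash -[RHS]row_mx0.
  rewrite -[X in _ = row_mx _ X]row_mx0 !mul0mx !(subr0, sub0r).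
  case/eq_row_mx => _ /eq_row_mx[/(lagr_mxP l2) h2 /(lagr_mxP lX)].
  by rewrite eqmx_opp => h3; apply: mxrankS; rewrite !sub_capmx submxMl h2.
split; apply: leq_trans rU _; rewrite leq_add2r; apply: posix_geq.
  exact: isotropic_has_pos.
have -> : \rank (U *m Q) = \rank (U *m (- Q)) by rewrite mulmxN mxrank_opp.
apply: isotropic_has_pos; first by rewrite raddfN /= Qs.
by rewrite mulmxN mulNmx UU oppr0.
Qed.

Lemma posix_block p q (Q1 : 'M[R]_p) (Q2 : 'M[R]_q) a b :
  has_pos Q1 a -> has_pos Q2 b -> has_pos (block_mx Q1 0 0 Q2) (a + b)%N.
Proof.
move=> [P PQ] [S SQ]; exists (block_mx P 0 0 S).
rewrite tr_block_mx !trmx0 !mulmx_block !(mulmx0, mul0mx, addr0, add0r) PQ SQ.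
by rewrite -scalar_mx_block.
Qed.

(* The diagonal L1 + L2 + (X :&: Y) is isotropic for the orthogonal difference
   of the two Kashiwara forms. *)
Lemma kash_difference X Y : lagr_mx X -> lagr_mx Y ->
  (n + (n + \rank (X :&: Y)%MS) <=
    posix (kash M1 M2 X) + posix (- kash M1 M2 Y)
    + \rank (X :&: Y :&: M1)%MS + \rank (X :&: Y :&: M2)%MS + \rank (M1 :&: M2)%MS)%N.
Proof.
move=> lX lY; set Q0 := kash _ _ X; set QT := kash _ _ Y.
have Q0s : Q0^T = Q0 by exact: kash_sym.
have QTs : QT^T = QT by exact: kash_sym.
have [g0 [gT [gE [gF gC]]]] := capmx_frame X Y.
set e := \rank (X :&: Y)%MS in g0 gT gE gF gC *.
pose D : 'M[R]_((n + (n + n)) + (n + (n + n))) := block_mx Q0 0 0 (- QT).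
have Ds : D^T = D by rewrite /D tr_block_mx !trmx0 Q0s raddfN /= QTs.
(* [A], [B], [C] are the block columns of the identity. [g0] and [gT] give the coordinates of the
   same vector of [X :&: Y] in [X] and in [Y], so both forms take the same values on the
   diagonal. *)
pose A : 'M[R]_(n + (n + e), n) := col_mx 1%:M 0.
pose B : 'M[R]_(n + (n + e), n) := col_mx 0 (col_mx 1%:M 0).
pose C : 'M[R]_(n + (n + e), e) := col_mx 0 (col_mx 0 1%:M).
pose U0 := row_mx A (row_mx B (C *m g0)).
pose UT := row_mx A (row_mx B (C *m gT)).
pose U := row_mx U0 UT.
have UU : U *m D *m U^T = 0.
  rewrite /D mul_row_block !mulmx0 addr0 add0r tr_row_mx mul_row_col mulmxN mulNmx.
  by rewrite !kash_form -!(mulmxA C) gE subrr.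
have rU : (n + (n + e) <= \rank (U *m D) + (\rank (X :&: Y :&: M1)%MS +
    \rank (X :&: Y :&: M2)%MS + \rank (M1 :&: M2)%MS))%N.
  rewrite -leq_subLR -mxrank_ker.
  set K := kermx _; have : K *m U *m D = 0 by rewrite -mulmxA mulmx_ker.
  have KE : K = row_mx (K *m A) (row_mx (K *m B) (K *m C)).
    rewrite -!mul_mx_row (_ : row_mx A (row_mx B C) = 1%:M) ?mulmx1 //.
    rewrite /A /B /C -[row_mx (col_mx 0 _) _]block_mxEh block_mxEv row_mx0.
    by rewrite -!block_mxEh -!scalar_mx_block.
  rewrite {2}KE.
  rewrite /U /U0 /UT !mul_mx_row !(mulmxA K).
  move: (K *m A) (K *m B) (K *m C) => a b c.
  rewrite /D mul_row_block !mulmx0 addr0 add0r !mulmxN -[RHS]row_mx0.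
  case/eq_row_mx => + /eqP; rewrite oppr_eq0 => + /eqP.
  rewrite !mul_kash -!(mulmxA c) -gE -[X in _ = X -> _]row_mx0.
  rewrite -[X in _ = row_mx _ X -> _]row_mx0.
  case/eq_row_mx => /(lagr_mxP l1) h1 /eq_row_mx[/(lagr_mxP l2) h2 /(lagr_mxP lX) h3].
  rewrite -[X in _ = X -> _]row_mx0 -[X in _ = row_mx _ X -> _]row_mx0.
  case/eq_row_mx => _ /eq_row_mx[_ /(lagr_mxP lY) h4].
  (* Being in the kernel for both forms puts [x2 - x1] in [X] and in [Y], so [X :&: Y] plays the
     part of the third space in [rank_triple]. *)
  have cXY : (c *m (g0 *m X) <= X :&: Y)%MS.
    by apply: submx_trans (submxMl _ _) _; rewrite gC.
  have h34 : (b *m M2 - a *m M1 <= X :&: Y)%MS by rewrite sub_capmx h3.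
  apply: (rank_triple l1.1 l2.1 gF); rewrite sub_capmx; apply/andP; split.
  - by rewrite addmx_sub // -opprB eqmx_opp.
  - by rewrite -addrA [- _ + _]addrC addmx_sub ?submxMl.
  - by rewrite addmx_sub.
  - by rewrite -addrA addmx_sub ?submxMl // addrC -opprB eqmx_opp.
  - by rewrite -addrA addmx_sub ?submxMl // -opprB eqmx_opp.
  - by rewrite [X in X - _]addrC -addrA addmx_sub ?submxMl.
have pD := isotropic_has_pos Ds UU.
(* A negative frame of [D] this large leaves room for at most [posix Q0 + posix (- QT)] positive
   directions. *)
have nD : has_pos (- D) (posix (- Q0) + posix QT)%N.
  rewrite /D opp_block_mx !oppr0 opprK; apply: posix_block; exact: posixP.
have := has_pos_sum_rank Ds pD nD; rewrite {2}/D rank_diag_block_mx mxrank_opp.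
have := posix_rank Q0s; have := posix_rank QTs.
move: rU; rewrite -/Q0 -/QT; move: (\rank (U *m D)); lia.
Qed.

End Triple.
End Kashiwara.

(** * Perturbation of the positive index *)

Section Perturbation.
Variable R : realType.

(** Convergence is taken entrywise, so that limits of products, transposes and blocks of any shape
    reduce to limits of reals. *)
Definition mcvg (T : Type) m n (F : set_system T) (A : T -> 'M[R]_(m, n))
    (A0 : 'M[R]_(m, n)) :=
  forall i j, A t i j @[t --> F] --> A0 i j.

Section mcvg_theory.
Variables (T : Type) (F : set_system T).
Context {FF : Filter F}.

Lemma mcvg_cst m n (A : 'M[R]_(m, n)) : mcvg F (fun=> A) A.
Proof. by move=> i j; exact: cvg_cst. Qed.

Lemma mcvgM m n p (A : T -> 'M[R]_(m, n)) (B : T -> 'M[R]_(n, p)) A0 B0 :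
  mcvg F A A0 -> mcvg F B B0 -> mcvg F (fun t => A t *m B t) (A0 *m B0).
Proof.
move=> hA hB i j; rewrite mxE.
under eq_fun do rewrite mxE.
by apply: (cvg_big add_continuous) => k _; apply: cvgM.
Qed.

Lemma mcvgD m n (A B : T -> 'M[R]_(m, n)) A0 B0 :
  mcvg F A A0 -> mcvg F B B0 -> mcvg F (fun t => A t + B t) (A0 + B0).
Proof.
move=> hA hB i j; rewrite mxE; under eq_fun do rewrite mxE.
exact: cvgD.
Qed.

Lemma mcvgN m n (A : T -> 'M[R]_(m, n)) A0 :
  mcvg F A A0 -> mcvg F (fun t => - A t) (- A0).
Proof.
move=> hA i j; rewrite mxE; under eq_fun do rewrite mxE.
exact: cvgN.
Qed.

Lemma mcvgZ m n (c : T -> R) (A : T -> 'M[R]_(m, n)) (c0 : R) A0 :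
  c @ F --> c0 -> mcvg F A A0 -> mcvg F (fun t => c t *: A t) (c0 *: A0).
Proof.
move=> hc hA i j; rewrite mxE; under eq_fun do rewrite mxE.
exact: cvgM.
Qed.

Lemma mcvg_tr m n (A : T -> 'M[R]_(m, n)) A0 :
  mcvg F A A0 -> mcvg F (fun t => (A t)^T) A0^T.
Proof. by move=> hA i j; rewrite mxE; under eq_fun do rewrite mxE; exact: hA. Qed.

Lemma mcvg_row m n1 n2 (A : T -> 'M[R]_(m, n1)) (B : T -> 'M[R]_(m, n2)) A0 B0 :
  mcvg F A A0 -> mcvg F B B0 -> mcvg F (fun t => row_mx (A t) (B t)) (row_mx A0 B0).
Proof.
move=> hA hB i j; rewrite mxE; under eq_fun do rewrite mxE.
case: (fintype.split j) => k; [exact: hA|exact: hB].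
Qed.

Lemma mcvg_col m1 m2 n (A : T -> 'M[R]_(m1, n)) (B : T -> 'M[R]_(m2, n)) A0 B0 :
  mcvg F A A0 -> mcvg F B B0 -> mcvg F (fun t => col_mx (A t) (B t)) (col_mx A0 B0).
Proof.
move=> hA hB i j; rewrite mxE; under eq_fun do rewrite mxE.
case: (fintype.split i) => k; [exact: hA|exact: hB].
Qed.

Lemma mcvg_near m n (A B : T -> 'M[R]_(m, n)) A0 :
  (\forall t \near F, A t = B t) -> mcvg F A A0 -> mcvg F B A0.
Proof.
move=> AB hA i j; apply: cvg_trans (hA i j); apply: near_eq_cvg.
by near=> t; rewrite (near AB t).
Unshelve. all: by end_near.
Qed.

End mcvg_theory.

(** Each term is bounded by [|a b| <= (a^2 + b^2) / 2]; in the double sum every square occurs [N]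
    times. *)
Lemma bilin_bound N (E : 'M[R]_N) (x y : 'rV[R]_N) (e : R) :
  (forall i j, `|E i j| <= e) ->
  `|(x *m E *m y^T) 0 0| <= e * N%:R / 2 * (\sum_i x 0 i ^+ 2 + \sum_i y 0 i ^+ 2).
Proof.
move=> Ee.
have -> : (x *m E *m y^T) 0 0 = \sum_j \sum_i x 0 i * E i j * y 0 j.
  by rewrite mxE; apply: eq_bigr => j _; rewrite !mxE big_distrl.
apply: le_trans (ler_norm_sum _ _ _) _.
apply: (@le_trans _ _ (\sum_(j < N) \sum_(i < N) e / 2 * (x 0 i ^+ 2 + y 0 j ^+ 2))).
  apply: ler_sum => j _; apply: le_trans (ler_norm_sum _ _ _) _.
  apply: ler_sum => i _; rewrite !normrM.
  have := Ee i j; move: (normr_ge0 (E i j)); move: (`|E i j|) => f f0 fe.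
  rewrite -[x 0 i ^+ 2]real_normK ?num_real // -[y 0 j ^+ 2]real_normK ?num_real //.
  move: (normr_ge0 (x 0 i)) (normr_ge0 (y 0 j)).
  move: (`|x 0 i|) (`|y 0 j|) => a b a0 b0.
  have ab : a * b <= (a ^+ 2 + b ^+ 2) / 2.
    by have := sqr_ge0 (a - b); rewrite !expr2; lra.
  rewrite mulrAC mulrC (le_trans (ler_wpM2l f0 ab)) //.
  have q0 : 0 <= (a ^+ 2 + b ^+ 2) / 2 by rewrite divr_ge0 // addr_ge0 ?sqr_ge0.
  by have := ler_wpM2r q0 fe; lra.
rewrite le_eqVlt; apply/orP; left; apply/eqP.
under eq_bigr do rewrite -mulr_sumr big_split /= sumr_const card_ord.
rewrite -mulr_sumr big_split /= sumr_const card_ord !sumrMnl.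
by rewrite -[(\sum_i x 0 i ^+ 2) *+ N]mulr_natr -[(\sum_i y 0 i ^+ 2) *+ N]mulr_natr; field.
Qed.

(** By [bilin_bound], [x M x^T] is at least [(1 - e N)] times the sum of squares of [x]. *)
Lemma near_id_frame N (M : 'M[R]_N) (e : R) : M^T = M ->
  (forall i j, `|M i j - (1%:M : 'M[R]_N) i j| <= e) -> e * N%:R < 1 -> has_pos M N.
Proof.
move=> Ms Me eN; apply: posdef_frame => // x x0.
pose s := \sum_i x 0 i ^+ 2.
have s0 : 0 < s.
  rewrite lt_neqAle sumr_ge0 ?andbT; last by move=> i _; rewrite sqr_ge0.
  apply: contra x0; rewrite eq_sym psumr_eq0; last by move=> i _; rewrite sqr_ge0.
  move=> /allP h; apply/eqP/rowP => i; rewrite mxE.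
  by have := h i; rewrite mem_index_enum sqrf_eq0 => /(_ isT)/eqP.
pose E := M - 1%:M.
have -> : (x *m M *m x^T) 0 0 = s + (x *m E *m x^T) 0 0.
  rewrite /E mulmxBr mulmxBl mulmx1 [in RHS]mxE [in X in _ + (_ + X)]mxE.
  rewrite [in X in _ + (_ - X)]mxE addrCA -[LHS]addr0; congr (_ + _).
  by apply/esym/eqP; rewrite subr_eq0; apply/eqP/eq_bigr => i _; rewrite mxE expr2.
have h : `|(x *m E *m x^T) 0 0| <= e * N%:R * s.
  have -> : e * N%:R * s = e * N%:R / 2 * (s + s) by field.
  by apply: bilin_bound => i j; have := Me i j; rewrite !mxE.
have : e * N%:R * s < s by rewrite -[ltRHS]mul1r ltr_pM2r.
by move: h; rewrite ler_norml => /andP[]; lra.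
Qed.

Lemma mcvg_id_frame (T : Type) (F : set_system T) {FF : Filter F} N (M : T -> 'M[R]_N) :
  (\forall t \near F, (M t)^T = M t) -> mcvg F M 1%:M ->
  \forall t \near F, has_pos (M t) N.
Proof.
move=> Ms M1; pose e : R := (N.+1%:R)^-1.
have e0 : 0 < e by rewrite invr_gt0 ltr0n.
have h : \forall t \near F, forall i j, `|M t i j - (1%:M : 'M[R]_N) i j| <= e.
  apply: filter_forall => i; apply: filter_forall => j.
  have /cvgrPdist_le/(_ e e0) := M1 i j.
  by apply: filterS => t; rewrite distrC.
near=> t; apply: (@near_id_frame _ _ e).
- by near: t.
- by near: t.
- by rewrite /e mulrC ltr_pdivrMr ?ltr0n // mul1r ltr_nat.
Unshelve. all: by end_near.
Qed.

(* Rescaling K by 1 / sqrt h makes the Gram matrix of the frame (P, K) for Q t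
   tend to the identity. *)
Lemma perturbed_frame (T : Type) (F : set_system T) {FF : Filter F} N p k
    (h : T -> R) (Q : T -> 'M[R]_N) (Q0 D : 'M[R]_N)
    (P : 'M[R]_(p, N)) (K : 'M[R]_(k, N)) :
  (\forall t \near F, 0 < h t) -> h @ F --> (0 : R) ->
  Q0^T = Q0 -> (\forall t \near F, (Q t)^T = Q t) ->
  mcvg F (fun t => (h t)^-1 *: (Q t - Q0)) D ->
  P *m Q0 *m P^T = 1%:M -> K *m Q0 = 0 -> K *m D *m K^T = 1%:M ->
  \forall t \near F, has_pos (Q t) (p + k)%N.
Proof.
move=> hp h0 Q0s Qs hD PP K0 KK.
pose S t := col_mx P ((Num.sqrt (h t))^-1 *: K).
pose A t := (h t)^-1 *: (Q t - Q0).
suff: \forall t \near F, has_pos (S t *m Q t *m (S t)^T) (p + k)%N.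
  apply: filterS => t [C CE]; exists (C *m S t).
  by rewrite trmx_mul !mulmxA in CE *.
apply: mcvg_id_frame.
  by near=> t; rewrite form_tr //; near: t.
have K0' : Q0 *m K^T = 0 by rewrite -[Q0]Q0s -trmx_mul K0 trmx0.
have sh : Num.sqrt (h t) @[t --> F] --> (0 : R).
  rewrite -[X in _ --> X]sqrtr0.
  by apply: (cvg_comp _ _ h0); exact: sqrt_continuous.
rewrite scalar_mx_block.
(* Expanding [Q t = Q0 + h A]: the kernel frame [K] kills [Q0], so the mixed blocks carry
   [h / sqrt h = sqrt h] and tend to 0, while in the last block [h] cancels. *)
apply: (@mcvg_near _ _ _ _ _ (fun t => block_mx
    (1%:M + h t *: (P *m A t *m P^T)) (Num.sqrt (h t) *: (P *m A t *m K^T))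
    (Num.sqrt (h t) *: (K *m A t *m P^T)) (K *m A t *m K^T))).
  near=> t.
  have ht : 0 < h t by near: t.
  have s0 : Num.sqrt (h t) != 0 by rewrite gt_eqF // sqrtr_gt0.
  have QE : Q t = Q0 + h t *: A t.
    by rewrite /A scalerA mulfV ?gt_eqF // scale1r addrC subrK.
  have ss : (Num.sqrt (h t))^-1 * h t = Num.sqrt (h t).
    by rewrite -{2}(sqr_sqrtr (ltW ht)) expr2 mulKf.
  have ss' : (Num.sqrt (h t))^-1 * Num.sqrt (h t) = 1 by rewrite mulVf.
  rewrite /S; symmetry; move: (A t) QE => At QE; rewrite col_mx_form QE; congr block_mx.
  - by rewrite mulmxDr mulmxDl PP -scalemxAr -scalemxAl.
  - rewrite [(_ *: K)^T]linearZ /= -scalemxAr mulmxDr mulmxDl -[P *m Q0 *m _]mulmxA K0' mulmx0.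
    by rewrite add0r -scalemxAr -scalemxAl scalerA ss.
  - by rewrite -!scalemxAl mulmxDr K0 add0r -scalemxAr -scalemxAl scalerA ss.
  - rewrite [(_ *: K)^T]linearZ /= -scalemxAr -!scalemxAl mulmxDr K0 add0r -scalemxAr.
    by rewrite -scalemxAl !scalerA -mulrA ss ss' scale1r.
have hPA m q (V : 'M[R]_(m, N)) (W : 'M[R]_(q, N)) :
    mcvg F (fun t => V *m A t *m W^T) (V *m D *m W^T).
  by apply: mcvgM; [apply: mcvgM => //|]; exact: mcvg_cst.
have -> : block_mx 1%:M 0 0 1%:M = block_mx (1%:M + 0 *: (P *m D *m P^T))
    (0 *: (P *m D *m K^T)) (0 *: (K *m D *m P^T)) (K *m D *m K^T).
  by rewrite !scale0r addr0 KK.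
apply: mcvg_col; apply: mcvg_row => //.
- by apply: mcvgD; [exact: mcvg_cst|apply: mcvgZ].
- exact: mcvgZ.
- exact: mcvgZ.
Unshelve. all: by end_near.
Qed.

End Perturbation.

(** * Counting jumps *)

Section Counting.
Variable R : realType.

(** Passing [t0] from left to right changes [p] by [x2 t0 - x1 t0]; at [t0] itself [p] does not
    exceed its values on either side. *)
Definition jump_law (x1 x2 p : R -> nat) (t0 t : R) :=
  (t0 < t -> [/\ x1 t = 0, x2 t = 0 & p t = p t0 + x2 t0]%N) /\
  (t < t0 -> [/\ x1 t = 0, x2 t = 0 & p t = p t0 + x1 t0]%N).

(** [p a + x2 a] stands for the value of [p] just after [a], and [p 0 + x1 0] for a value just
    before 0, so every instant of [s] contributes its whole jump. Members of [s] need not be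
    crossings. *)
Definition jump_count (x1 x2 p : R -> nat) (a : R) (s : seq R) :=
  [/\ uniq s, (forall t, t \in s -> 0 <= t <= a),
    (forall t, 0 <= t <= a -> t \notin s -> x1 t = 0%N /\ x2 t = 0%N) &
    (p a + x2 a + \sum_(t <- s) x1 t = p 0%R + x1 0%R + \sum_(t <- s) x2 t)%N].

Lemma jump_count_extend_right x1 x2 p a b s :
  0 <= a -> a < b -> jump_law x1 x2 p a b ->
  (forall t, a < t -> t <= b -> jump_law x1 x2 p a t) ->
  jump_count x1 x2 p a s -> jump_count x1 x2 p b s.
Proof.
move=> a0 ab [/(_ ab) [x1b x2b pb] _] hab [us sa sx sp]; split => //.
- by move=> t /sa /andP[-> /= ta]; rewrite (le_trans ta) // ltW.
- move=> t /andP[t0 tb] ts; have [ta|at_] := leP t a; first by apply: sx; rewrite ?t0.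
  by have [/(_ at_) [-> ->]] := hab _ at_ tb.
- by rewrite pb x2b; lia.
Qed.

Lemma jump_count_extend_limit x1 x2 p a b s :
  0 <= a -> a < b -> jump_law x1 x2 p b a ->
  (forall t, a <= t -> t < b -> jump_law x1 x2 p b t) ->
  jump_count x1 x2 p a s -> jump_count x1 x2 p b (b :: s).
Proof.
move=> a0 ab [_ /(_ ab) [x1a x2a pa]] hab [us sa sx sp]; split => //.
- by rewrite /= us andbT; apply/negP => /sa /andP[_]; rewrite leNgt ab.
- move=> t; rewrite inE => /orP[/eqP ->|/sa /andP[-> /= ta]].
    by rewrite lexx (le_trans a0) // ltW.
  by rewrite (le_trans ta) // ltW.
- move=> t /andP[t0 tb]; rewrite inE negb_or => /andP[tb' ts].
  have [ta|at_] := leP t a; first by apply: sx; rewrite ?t0.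
  have {}tb : t < b by rewrite lt_neqAle tb'.
  by have [_ /(_ tb) [-> ->]] := hab _ (ltW at_) tb.
- by rewrite !big_cons; move: sp; rewrite pa x2a; lia.
Qed.

(** Compactness of [[0, T]] in the form of a supremum: the times up to which the count holds reach
    their supremum by the left law there, and could be pushed beyond it by the right law if it were
    below [T]. *)
Lemma jump_counting (T : R) (x1 x2 p : R -> nat) : 0 < T ->
  (forall t0 : R, 0 <= t0 <= T -> exists2 e : R, 0 < e &
    forall t : R, 0 <= t <= T -> `|t - t0| < e -> jump_law x1 x2 p t0 t) ->
  exists s, jump_count x1 x2 p T s.
Proof.
move=> T0 loc.
pose A := [set a : R | 0 <= a <= T /\ exists s, jump_count x1 x2 p a s].
have A0 : A 0.
  split; first by rewrite lexx ltW.
  exists [:: 0]; split => //.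
  - by move=> t; rewrite inE => /eqP ->; rewrite lexx.
  - by move=> t t0; rewrite inE eq_le andbC t0.
  - by rewrite !big_seq1; lia.
have ubA : ubound A T by move=> a [/andP[]].
have sA : has_sup A by split; [exists 0|exists T].
pose s := sup A.
have s0 : 0 <= s by apply: ub_le_sup => //; exists T.
have sT : s <= T by apply: ge_sup => //; exists 0.
have [|e e0 he] := loc s; first by rewrite s0 sT.
have [a [/andP[a0 aT] [sq sqP]] sa] := sup_adherent e0 sA.
have as_ : a <= s by apply: ub_le_sup; [exists T|split; [rewrite a0 aT|exists sq]].
have [q qP] : exists q, jump_count x1 x2 p s q.
  move: as_; rewrite le_eqVlt => /orP[/eqP <-|as_]; first by exists sq.
  have hab t : a <= t -> t < s -> jump_law x1 x2 p s t.
    move=> at_ ts; apply: he; first by rewrite (le_trans a0 at_) (le_trans (ltW ts)).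
    by rewrite ltr_norml; move: sa; rewrite -/s; lra.
  by exists (s :: sq); apply: (jump_count_extend_limit a0 as_ _ hab sqP); exact: hab.
move: sT; rewrite le_eqVlt => /orP[/eqP <-|sT]; first by exists q.
pose b := Num.min T (s + e / 2).
have sb : s < b by rewrite lt_min sT /=; lra.
have hab t : s < t -> t <= b -> jump_law x1 x2 p s t.
  rewrite le_min => st /andP[tT te]; apply: he; first by rewrite tT (le_trans s0) ?ltW.
  by rewrite ltr_norml; lra.
have bA : A b.
  split; first by rewrite (le_trans s0 (ltW sb)) ge_min lexx.
  exists q; apply: (jump_count_extend_right s0 sb _ hab qP).
  by apply: hab.
by have := ub_le_sup (ex_intro _ T ubA) bA; rewrite leNgt -/s sb.
Qed.

End Counting.

(** * One-sided derivatives *)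

Section PuncturedFilter.
Variables (R : realType) (T : R).

(** The filter of [deriv_within 0 T]; it is one-sided at the two endpoints. *)
Definition pnbhs (t0 : R) : set_system R :=
  within [set t | t != t0 /\ 0 <= t <= T] (nbhs t0).

Global Instance pnbhs_filter t0 : Filter (pnbhs t0).
Proof. exact: within_filter. Qed.

Lemma near_pnbhsP (t0 : R) (P : R -> Prop) :
  (\forall t \near pnbhs t0, P t) <->
  exists2 e, 0 < e & forall t, 0 <= t <= T -> t != t0 -> `|t - t0| < e -> P t.
Proof.
split.
  move=> /nbhs_ballP[e /= e0 he]; exists e => // t tT tt0 te.
  by apply: he => //; rewrite /ball /= distrC.
move=> [e e0 he]; apply/nbhs_ballP; exists e => //= t.
by rewrite /ball /= distrC => te [tt0 tT]; exact: he.
Qed.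

Lemma pnbhs_proper (t0 : R) : 0 < T -> 0 <= t0 <= T -> ProperFilter (pnbhs t0).
Proof.
move=> T0 /andP[t00 t0T]; apply: Build_ProperFilter_ex => P /near_pnbhsP[e e0 he].
have [t0T'|t0T'] := ltP t0 T.
  pose t := Num.min T (t0 + e / 2).
  have t1 : t0 < t by rewrite lt_min t0T' /=; lra.
  have t2 : t <= t0 + e / 2 by rewrite ge_min lexx orbT.
  exists t; apply: he; [|by rewrite gt_eqF|by rewrite ltr_norml; lra].
  by rewrite (le_trans t00 (ltW t1)) ge_min lexx.
pose t := Num.max 0 (t0 - e / 2).
have t1 : t < t0 by rewrite gt_max; apply/andP; split; lra.
have t2 : t0 - e / 2 <= t by rewrite le_max lexx orbT.
exists t; apply: he; [|by rewrite lt_eqF|by rewrite ltr_norml; lra].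
by rewrite (le_trans (ltW t1) t0T) le_max lexx.
Qed.

Lemma pnbhs_cvg (t0 : R) : t - t0 @[t --> pnbhs t0] --> (0 : R).
Proof.
apply/cvgr0Pnorm_lt => e e0; apply/near_pnbhsP; exists e => //.
Qed.

Lemma pnbhs_neq (t0 : R) : \forall t \near pnbhs t0, t - t0 != 0.
Proof. by apply/near_pnbhsP; exists 1 => // t _ tt0 _; rewrite subr_eq0. Qed.

Lemma pnbhs_bound (t0 : R) : \forall t \near pnbhs t0, 0 <= t <= T.
Proof. by apply/near_pnbhsP; exists 1. Qed.

Definition mderiv m n (A : R -> 'M[R]_(m, n)) (t0 : R) (D : 'M[R]_(m, n)) :=
  mcvg (pnbhs t0) (fun t => (t - t0)^-1 *: (A t - A t0)) D.

Lemma deriv_within_mderiv m n (A : R -> 'M[R]_(m, n)) (t0 : R) D :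
  deriv_within 0 T A t0 D -> mderiv A t0 D.
Proof.
move=> h i j.
apply: (cvg_comp _ (fun M : 'M[R]_(m, n) => M i j) h).
exact: coord_continuous.
Qed.

Lemma mderiv_cvg m n (A : R -> 'M[R]_(m, n)) (t0 : R) D :
  mderiv A t0 D -> mcvg (pnbhs t0) A (A t0).
Proof.
move=> h.
have -> : A t0 = A t0 + 0 *: D by rewrite scale0r addr0.
apply: (@mcvg_near _ _ _ _ _ _
  (fun t => A t0 + (t - t0) *: ((t - t0)^-1 *: (A t - A t0)))); last first.
  by apply: mcvgD; [exact: mcvg_cst|apply: mcvgZ => //; exact: pnbhs_cvg].
near=> t; have tt0 : t - t0 != 0 by near: t; exact: pnbhs_neq.
by rewrite scalerA mulfV // scale1r addrC subrK.
Unshelve. all: by end_near.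
Qed.

Lemma mderivM m n p (A : R -> 'M[R]_(m, n)) (B : R -> 'M[R]_(n, p)) t0 A' B' :
  mderiv A t0 A' -> mderiv B t0 B' ->
  mderiv (fun t => A t *m B t) t0 (A' *m B t0 + A t0 *m B').
Proof.
move=> hA hB.
apply: (@mcvg_near _ _ _ _ _ _ (fun t => ((t - t0)^-1 *: (A t - A t0)) *m B t
    + A t0 *m ((t - t0)^-1 *: (B t - B t0)))).
  near=> t; rewrite -scalemxAl -scalemxAr -scalerDr mulmxBl mulmxBr addrA.
  by rewrite subrK.
apply: mcvgD; apply: mcvgM => //; [exact: mderiv_cvg hB|exact: mcvg_cst].
Unshelve. all: by end_near.
Qed.

Lemma mderiv_cst m n (A : 'M[R]_(m, n)) t0 : mderiv (fun=> A) t0 0.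
Proof.
rewrite /mderiv; under eq_fun do rewrite subrr scaler0.
exact: mcvg_cst.
Qed.

Lemma mderiv_tr m n (A : R -> 'M[R]_(m, n)) t0 A' :
  mderiv A t0 A' -> mderiv (fun t => (A t)^T) t0 A'^T.
Proof.
move=> hA; rewrite /mderiv.
under eq_fun do rewrite -linearB -linearZ /=.
exact: mcvg_tr.
Qed.

Lemma deriv_within0_cst (f : R -> R) :
  (forall x, 0 <= x <= T -> (t - x)^-1 * (f t - f x) @[t --> pnbhs x] --> (0 : R)) ->
  forall t, 0 <= t <= T -> f t = f 0.
Proof.
move=> hf t /andP[]; rewrite le_eqVlt => /orP[/eqP <- //|t0 tT].
have [||c _] := @MVT R f (fun=> 0) 0 t t0; last first.
- by rewrite mul0r => /eqP; rewrite subr_eq0 => /eqP.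
- apply/subspace_continuousP => x /=; rewrite in_itv /= => /andP[x0 xt].
  (* A difference quotient smaller than 1 in absolute value gives [|f y - f x| < |y - x|] near [x],
     hence continuity up to the endpoints. *)
  have /hf/cvgr0Pnorm_lt/(_ 1 ltr01)/near_pnbhsP[e e0 he] : 0 <= x <= T.
    by rewrite x0 (le_trans xt).
  apply/cvgrPdist_lt => eps eps0; apply/nbhs_ballP.
  exists (Num.min e eps); first by rewrite /= lt_min e0.
  move=> y; rewrite /ball /= lt_min => /andP[xe xeps]; rewrite in_itv /= => /andP[y0 yt].
  have [->|yx] := eqVneq y x; first by rewrite subrr normr0.
  have := he y; rewrite y0 (le_trans yt tT) distrC => /(_ isT yx xe).
  rewrite normrM normfV mulrC ltr_pdivrMr ?normr_gt0 ?subr_eq0 // mul1r distrC => h.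
  by rewrite distrC (lt_trans _ xeps) // distrC (distrC x) .
- move=> x; rewrite in_itv /= => /andP[x0 xt].
  have xT : x < T by exact: lt_le_trans tT.
  suff h : h^-1 *: ((f \o shift x) (h *: 1) - f x) @[h --> 0^'] --> (0 : R).
    by apply: DeriveDef; [apply/cvg_ex; exists 0|exact: cvg_lim h].
  have /hf hx : 0 <= x <= T by rewrite !ltW.
  apply/cvgr0Pnorm_lt => eps eps0.
  have /cvgr0Pnorm_lt/(_ eps eps0)/near_pnbhsP[e e0 he] := hx.
  near=> h.
  have h0 : h != 0 by near: h; exact: nbhs_dnbhs_neq.
  have := he (h + x); rewrite addrK /= /shift /= [h *: 1]mulr1; apply.
  + have : `|h| < x by near: h; exact: dnbhs0_lt.
    have : `|h| < T - x by near: h; apply: dnbhs0_lt; rewrite subr_gt0.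
    by rewrite !ltr_norml => /andP[_ h1] /andP[h2 _]; apply/andP; split; lra.
  + by rewrite -subr_eq0 addrK.
  + by near: h; exact: dnbhs0_lt.
Unshelve. all: by end_near.
Qed.

End PuncturedFilter.

(** * Subspaces and matrices *)

Section Bridge.
Variable R : realType.

(** Passes from spaces of column vectors, used in the theorem, to row spaces, used in the index
    calculus. *)
Definition spans N m (L : {vspace 'cV[R]_N}) (M : 'M[R]_(m, N)) :=
  forall v : 'cV[R]_N, (v \in L) = (v^T <= M)%MS.

Lemma spans_frame N (L : {vspace 'cV[R]_N}) :
  exists2 M : 'M[R]_(\dim L, N), row_free M & spans L M.
Proof.
pose b := vbasis L.
pose M : 'M[R]_(\dim L, N) := \matrix_(i < \dim L) (b`_i)^T.
have ME (c : 'rV[R]_(\dim L)) : c *m M = (\sum_(i < \dim L) c 0 i *: b`_i)^T.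
  rewrite mulmx_sum_row linear_sum /=; apply: eq_bigr => i _.
  by rewrite rowK linearZ.
exists M.
  apply: inj_row_free => c; rewrite ME => /(congr1 trmx); rewrite trmxK trmx0 => c0.
  have /freeP/(_ (fun i => c 0 i)) := basis_free (vbasisP L).
  by move=> /(_ c0) c0'; apply/rowP => i; rewrite c0' mxE.
move=> v; apply/idP/submxP => [vL|[c vE]].
  exists (\row_i coord b i v); rewrite ME; congr trmx.
  rewrite {1}(coord_vbasis vL); apply: eq_bigr => i _.
  by rewrite mxE.
rewrite -[v]trmxK vE ME trmxK; apply: memv_suml => i _.
by apply: memvZ; apply: vbasis_mem; apply: mem_nth; rewrite size_tuple.
Qed.

Lemma spans_dim N m (L : {vspace 'cV[R]_N}) (M : 'M[R]_(m, N)) :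
  spans L M -> \dim L = \rank M.
Proof.
move=> LM; have [A Af LA] := spans_frame L.
rewrite -(eqP Af); apply/eqP; rewrite eqn_leq; apply/andP.
split; apply/mxrankS/row_subP => i.
  by rewrite -[row i A]trmxK -LM LA trmxK row_sub.
by rewrite -[row i M]trmxK -LA LM trmxK row_sub.
Qed.

Lemma spans_cap N m1 m2 (L1 L2 : {vspace 'cV[R]_N}) (M1 : 'M[R]_(m1, N))
    (M2 : 'M[R]_(m2, N)) :
  spans L1 M1 -> spans L2 M2 -> spans (L1 :&: L2) (M1 :&: M2)%MS.
Proof. by move=> h1 h2 v; rewrite memv_cap sub_capmx h1 h2. Qed.

Lemma memv_mx_img n (A : 'M[R]_(n + n)) (L : {vspace 'cV[R]_(n + n)}) v :
  reflect (exists2 u, u \in L & v = A *m u) (v \in mx_img A L).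
Proof.
apply: (iffP memv_imgP) => -[u uL ->]; exists u => //; by rewrite lfunE.
Qed.

Lemma spans_mx_img n m (A : 'M[R]_(n + n)) (L : {vspace 'cV[R]_(n + n)})
    (M : 'M[R]_(m, n + n)) : spans L M -> spans (mx_img A L) (M *m A^T).
Proof.
move=> LM v; apply/memv_mx_img/idP => [[u]|/submxP[c cE]].
  by rewrite LM => uM ->; rewrite trmx_mul submxMr.
exists (c *m M)^T; first by rewrite LM trmxK submxMl.
by rewrite -[A]trmxK -trmx_mul -[v]trmxK cE mulmxA.
Qed.

End Bridge.

(** * The symplectic form as a matrix *)

Section SymplecticMatrix.
Variables (R : realType) (n : nat).
Local Notation J := (J0 R n).
(** The Gram matrix of [omega0], which is also the inverse of [J0]. *)
Definition Omx : 'M[R]_(n + n) := - J.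

Lemma J0_tr : J^T = - J.
Proof.
by rewrite /J0 tr_block_mx opp_block_mx !trmx0 raddfN /= trmx1 oppr0 opprK.
Qed.

Lemma J0_sqr : J *m J = - 1%:M.
Proof.
rewrite /J0 mulmx_block !(mulmx0, mul0mx) !mulmxN !mulNmx !mulmx1 !add0r !addr0.
by rewrite [in RHS]scalar_mx_block opp_block_mx !oppr0.
Qed.

Lemma Omx_tr : Omx^T = - Omx.
Proof. by rewrite /Omx raddfN /= J0_tr. Qed.

Lemma Omx_J0 : Omx *m J = 1%:M.
Proof. by rewrite /Omx mulNmx J0_sqr opprK. Qed.

Lemma Omx_unit : Omx \in unitmx.
Proof. by have [] := mulmx1_unit Omx_J0. Qed.

Lemma omega0E (u v : 'cV[R]_(n + n)) : omega0 u v = (u^T *m Omx *m v) 0 0.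
Proof.
have -> : Omx = block_mx 0 1%:M (- 1%:M) 0.
  by rewrite /Omx /J0 opp_block_mx !oppr0 opprK.
rewrite -[u]vsubmxK -[v]vsubmxK tr_col_mx mul_row_block !mulmx0 add0r addr0.
rewrite mulmxN !mulmx1 mul_row_col mulNmx addrC.
rewrite [in RHS]mxE [X in _ = X + _]mxE [X in _ = _ + X]mxE [X in _ = _ + - X]mxE.
rewrite -sumrB; apply: eq_bigr => i _.
by rewrite !col_mxEu !col_mxEd !mxE.
Qed.

Lemma lagrangian_frame (L : {vspace 'cV[R]_(n + n)}) : lagrangian L ->
  exists2 M : 'M[R]_(n, n + n), lagr_mx Omx M & spans L M.
Proof.
move=> [dL LL]; have [M Mf LM] := spans_frame L.
move: M Mf LM; rewrite dL => M Mf LM; exists M => //; split => //.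
apply/matrixP => i j; rewrite [RHS]mxE.
have := LL (row i M)^T (row j M)^T; rewrite !LM !trmxK !row_sub => /(_ isT isT).
rewrite omega0E trmxK => <-.
by rewrite !mxE; apply: eq_bigr => k _; rewrite !mxE; congr (_ * _);
  apply: eq_bigr => l _; rewrite !mxE.
Qed.

Lemma lagr_mx_lagrangian (L : {vspace 'cV[R]_(n + n)}) (M : 'M[R]_(n, n + n)) :
  lagr_mx Omx M -> spans L M -> lagrangian L.
Proof.
move=> [Mf MM] LM; split; first by rewrite (spans_dim LM) (eqP Mf).
move=> u v; rewrite !LM => /submxP[a aE] /submxP[b bE].
rewrite omega0E aE -[v]trmxK bE trmx_mul !mulmxA -(mulmxA a M) -(mulmxA a) MM.
by rewrite mulmx0 mul0mx mxE.
Qed.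

End SymplecticMatrix.

(** * The Hamiltonian flow *)

Section Flow.
Variables (R : realType) (n : nat) (T : R).
Variables (B psi : R -> 'M[R]_(n + n)).
Local Notation J := (J0 R n).
Local Notation Om := (Omx R n).
Hypotheses (T_gt0 : 0 < T) (Bs : forall t, 0 <= t <= T -> (B t)^T = B t).
Hypothesis psi0 : psi 0 = 1%:M.
Hypothesis psi' : forall t, 0 <= t <= T -> mderiv T psi t (J *m B t *m psi t).

Lemma J0_tr_Omx : J^T *m Om = - 1%:M.
Proof. by rewrite J0_tr /Omx mulNmx mulmxN opprK J0_sqr. Qed.

(** The derivative of [psi^T Om psi] is [- psi^T B psi + psi^T B psi], because [J^T Om = -1],
    [Om J = 1] and [B] is symmetric. *)
Lemma flow_symplectic t : 0 <= t <= T -> (psi t)^T *m Om *m psi t = Om.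
Proof.
move=> tT; transitivity ((psi 0)^T *m Om *m psi 0); last first.
  by rewrite psi0 trmx1 mul1mx mulmx1.
apply/matrixP => i j; move: t tT.
apply: (@deriv_within0_cst R T (fun t => ((psi t)^T *m Om *m psi t) i j)) => x xT.
have := mderivM (mderivM (mderiv_tr (psi' xT)) (mderiv_cst T Om x)) (psi' xT).
rewrite mulmx0 addr0 => /(_ i j).
rewrite !trmx_mul Bs // !mulmxA -[_ *m B x *m J^T *m Om]mulmxA J0_tr_Omx.
rewrite -[(psi x)^T *m Om *m J]mulmxA Omx_J0 mulmx1 [_ *m (- 1%:M)]mulmxN mulmx1 mulNmx addNr.
rewrite [X in _ --> X]mxE.
by under eq_fun do rewrite mxE [X in _ * X]mxE [X in _ * (_ + X)]mxE.
Qed.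

Lemma flow_unit t : 0 <= t <= T -> psi t \in unitmx.
Proof.
move=> tT; have := Omx_unit R n; rewrite -(flow_symplectic tT).
by rewrite !unitmx_mul => /andP[].
Qed.

Lemma flow_frame (M : 'M[R]_(n, n + n)) t :
  0 <= t <= T -> lagr_mx Om M -> lagr_mx Om (M *m (psi t)^T).
Proof.
move=> tT [Mf MM]; split.
  rewrite /row_free mxrankMfree //.
  by rewrite row_free_unit unitmx_tr flow_unit.
rewrite trmx_mul trmxK -!mulmxA (mulmxA (psi t)^T) (mulmxA _ (psi t)).
by rewrite flow_symplectic // mulmxA.
Qed.

(** A solution that is small because the right side is at most a small multiple of [|u|^2 + |y|^2].
    It yields the continuity at [t0] of the curve [w] in the crossing form, which the definition of
    that form does not contain. *)
Lemma small_solution (F : set_system R) {FF : Filter F} N (u : R -> 'cV[R]_N)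
    (De : R -> 'M[R]_N) (y : 'cV[R]_N) :
  mcvg F De 0 ->
  (\forall t \near F, (u t)^T *m u t =
    - ((u t)^T *m (De t)^T *m y) - (u t)^T *m (De t)^T *m u t) ->
  mcvg F u 0.
Proof.
move=> De0 uE i j; rewrite ord1 mxE => {j}.
apply/cvgr0Pnorm_le => eps eps0.
pose Y := \sum_i y^T 0 i ^+ 2.
have Y0 : 0 <= Y by apply: sumr_ge0 => k _; exact: sqr_ge0.
(* With [s = |u|^2] and [Y = |y|^2], the two bounds give [s <= (3/2) e N s + (1/2) e N Y]. The value
   [1/3] makes the first coefficient at most [1/2], so [s <= e N Y <= eps^2]. *)
pose k := Num.min (3^-1) (eps ^+ 2).
have k0 : 0 < k by rewrite lt_min exprn_gt0 // invr_gt0 ltr0n.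
have k1 : k <= 3^-1 by rewrite ge_min lexx.
have k2 : k <= eps ^+ 2 by rewrite ge_min lexx orbT.
pose e := k / (N.+1%:R * (Y + 1)).
have d0 : 0 < N.+1%:R * (Y + 1) by rewrite mulr_gt0 ?ltr0n //; lra.
have e0 : 0 < e by rewrite divr_gt0.
have eN : e * N%:R * (Y + 1) <= k.
  rewrite -[leRHS](divfK (lt0r_neq0 d0)) -/e -mulrA ler_pM2l // ler_pM2r; last by lra.
  by rewrite ler_nat.
have eN0 : 0 <= e * N%:R by rewrite mulr_ge0 ?ler0n // ltW.
have h : \forall t \near F, forall i j, `|De t i j| <= e.
  apply: filter_forall => a; apply: filter_forall => b.
  by have := De0 a b; rewrite mxE => /cvgr0Pnorm_le/(_ e e0).
near=> t.
have Dt : forall i j, `|(De t)^T i j| <= e.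
  by move=> a b; rewrite mxE; move: b a; near: t; apply: filterS h => t h a b.
pose s := \sum_i (u t)^T 0 i ^+ 2.
have sE : ((u t)^T *m u t) 0 0 = s.
  by rewrite mxE; apply: eq_bigr => l _; rewrite !mxE expr2.
have ut : (u t)^T *m u t =
    - ((u t)^T *m (De t)^T *m y) - (u t)^T *m (De t)^T *m u t by near: t.
have b1 := @bilin_bound R N (De t)^T (u t)^T y^T e Dt.
have b2 := @bilin_bound R N (De t)^T (u t)^T (u t)^T e Dt.
move/matrixP/(_ 0 0): ut; rewrite sE [RHS]mxE [X in X + _]mxE [X in _ + X]mxE.
move: b1 b2; rewrite !trmxK -/s -/Y !ler_norml => /andP[b1 _] /andP[b2 _] ut.
have sk : s <= eps ^+ 2.
  have s0 : 0 <= s by apply: sumr_ge0 => l _; exact: sqr_ge0.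
  have p1 : 0 <= e * N%:R * Y by rewrite mulr_ge0.
  have c1 : e * N%:R <= 3^-1 by move: eN; rewrite mulrDr mulr1; lra.
  have c2 : e * N%:R * s <= 3^-1 * s by rewrite ler_wpM2r.
  by move: eN; rewrite mulrDr mulr1; move: ut b1 b2; lra.
have : u t i 0 ^+ 2 <= eps ^+ 2.
  apply: le_trans sk; rewrite /s (bigD1 i) //= mxE lerDl.
  by apply: sumr_ge0 => l _; exact: sqr_ge0.
rewrite -[leLHS]real_normK ?num_real // ler_pXn2r ?nnegrE ?normr_ge0 //; last exact: ltW.
by rewrite ler_norml.
Unshelve. all: by end_near.
Qed.

Variables (L : {vspace 'cV[R]_(n + n)}) (M : 'M[R]_(n, n + n)).
Hypotheses (lM : lagr_mx Om M) (LM : spans L M).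
Local Notation ell := (fun t => mx_img (psi t) L).

Lemma flow_spans t : spans (ell t) (M *m (psi t)^T).
Proof. exact: spans_mx_img. Qed.

Lemma flow_lagrangian t : 0 <= t <= T -> lagrangian (ell t).
Proof.
by move=> tT; apply: lagr_mx_lagrangian (flow_spans t); exact: flow_frame.
Qed.

Lemma isotropic_mx (V : {vspace 'cV[R]_(n + n)}) u v :
  lagrangian V -> u \in V -> v \in V -> u^T *m Om *m v = 0.
Proof.
move=> [_ VV] uV vV; apply/matrixP => i j; rewrite !ord1 [RHS]mxE.
by rewrite -omega0E VV.
Qed.

(** [J0] maps a Lagrangian to its Euclidean orthogonal complement, as [u^T Om (J u) = u^T u]. This
    is the [W] at which the plus condition is evaluated. *)
Lemma transverse_complement t : 0 <= t <= T ->
  lagrangian (mx_img J (ell t)) /\ (ell t :&: mx_img J (ell t))%VS = 0%VS.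
Proof.
move=> tT; have lt := flow_lagrangian tT; split.
  apply: lagr_mx_lagrangian (spans_mx_img J (@flow_spans t)).
  have := flow_frame tT lM; move: (M *m _) => X [Xf XX]; split.
    rewrite /row_free mxrankMfree //.
    by rewrite row_free_unit unitmx_tr; have [] := mulmx1_unit (Omx_J0 R n).
  rewrite trmx_mul trmxK -!mulmxA (mulmxA Om) Omx_J0 mul1mx J0_tr mulmxA.
  exact: XX.
apply/eqP; rewrite -subv0; apply/subvP => z; rewrite memv_cap.
case/andP => zl /memv_mx_img[u ul zE]; rewrite memv0.
have := isotropic_mx lt ul zl; rewrite zE mulmxA -(mulmxA u^T) Omx_J0 mulmx1.
rewrite -{2}(trmxK u) => /mulmx_tr_eq0/(congr1 trmx); rewrite trmxK trmx0 => ->.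
by rewrite mulmx0.
Qed.

(** The crossing form is [v^T B v]. Both [v + De v = psi(t) psi(t0)^-1 v] and [v + w] lie in the
    Lagrangian [ell t], so [w0(v, w) = - w0(De v, v) - w0(De v, w)]. Divided by [t - t0], the first
    term tends to [- w0(J B v, v) = v^T B v] and the second to 0, since [w] does. *)
Lemma plus_curve_posdef (L0 : {vspace 'cV[R]_(n + n)}) t0 v :
  plus_curve T ell L0 -> 0 <= t0 <= T ->
  v \in ell t0 -> v \in L0 -> v != 0 -> 0 < (v^T *m B t0 *m v) 0 0.
Proof.
move=> plus tT vl vL0 v0.
have vcap : v \in (ell t0 :&: L0)%VS by rewrite memv_cap vl.
have cr : crossing T ell L0 t0.
  by split => //; apply: contraNneq v0 => c0; rewrite -memv0 -c0.
have lt := flow_lagrangian tT.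
have [lW dW] := transverse_complement tT.
have [c [w [wnear wd]] c0] := plus t0 cr _ lW dW v vcap v0.
have FF := pnbhs_proper T_gt0 tT.
have wt0 : w t0 = 0.
  have /= [wW wl] := nbhs_singleton wnear tT.
  apply/eqP; rewrite -memv0 -dW memv_cap wW andbT.
  by rewrite -(addKr v (w t0)) rpredD // rpredN.
have wn : \forall t \near pnbhs T t0, w t \in mx_img J (ell t0) /\ v + w t \in ell t.
  have : nbhs t0 _ := wnear; rewrite /pnbhs /prop_near1 /within /=.
  by apply: filterS => t h [_ tT']; exact: h.
pose u t := - (J *m w t).
have wE t : w t = J *m u t by rewrite /u mulmxN mulmxA J0_sqr mulNmx mul1mx opprK.
pose De t := (psi t - psi t0) *m invmx (psi t0).
have psiD : mcvg (pnbhs T t0) (fun t => psi t - psi t0) 0.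
  rewrite -(subrr (psi t0)); apply: mcvgD; last exact: mcvg_cst.
  exact: mderiv_cvg (psi' tT).
have De0 : mcvg (pnbhs T t0) De 0.
  by rewrite -(mul0mx _ (invmx (psi t0))); apply: mcvgM => //; exact: mcvg_cst.
have uP t z : z \in ell t0 -> z + De t *m z \in ell t.
  move=> /memv_mx_img[x xL ->]; rewrite /De -mulmxA (mulmxA (invmx _)).
  rewrite mulVmx ?flow_unit // mul1mx mulmxBl addrC subrK.
  by apply/memv_mx_img; exists x.
have w0 : mcvg (pnbhs T t0) w 0.
  have u0 : mcvg (pnbhs T t0) u 0.
    (* Here [w = J u] with [u] in [ell t0]. Isotropy of [ell t] for [u + De u] and [v + J u]
       isolates [u^T u], because [w0(u, v) = 0] and [w0(u, J u) = u^T u]. *)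
    apply: (small_solution (y := Om *m v) De0); near=> t.
    have [] : w t \in mx_img J (ell t0) /\ v + w t \in ell t by near: t.
    have ttT : 0 <= t <= T by near: t; exact: pnbhs_bound.
    case/memv_mx_img => z zl wz vw.
    have uz : u t = z by rewrite /u wz mulmxA J0_sqr mulNmx mul1mx opprK.
    have := isotropic_mx (flow_lagrangian ttT) (uP t z zl) vw.
    rewrite wz -uz in zl *.
    rewrite [(_ + _)^T]linearD /= trmx_mul !mulmxDl !mulmxDr (isotropic_mx lt zl vl) add0r.
    rewrite [(u t)^T *m Om *m (J *m _)]mulmxA -[(u t)^T *m Om *m J]mulmxA Omx_J0 mulmx1.
    rewrite [_ *m Om *m (J *m _)]mulmxA -[_ *m Om *m J]mulmxA Omx_J0 mulmx1.
    rewrite -[(u t)^T *m (De t)^T *m Om *m v]mulmxA addrA => /eqP.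
    by rewrite -addrA addr_eq0 opprD => /eqP.
  rewrite -(mulmx0 _ J); apply: (@mcvg_near _ _ _ _ _ _ (fun t => J *m u t)).
    by near=> t; rewrite wE.
  by apply: mcvgM => //; exact: mcvg_cst.
pose q t := (t - t0)^-1 *: (psi t - psi t0) *m invmx (psi t0) *m v.
have q0 : mcvg (pnbhs T t0) q (J *m B t0 *m v).
  have -> : J *m B t0 *m v = J *m B t0 *m psi t0 *m invmx (psi t0) *m v.
    by rewrite mulmxK // flow_unit.
  apply: mcvgM; last exact: mcvg_cst.
  by apply: mcvgM; [exact: psi'|exact: mcvg_cst].
have G0 : mcvg (pnbhs T t0) (fun t => - ((q t)^T *m Om *m v) - (q t)^T *m Om *m w t)
    (v^T *m B t0 *m v).
  have -> : v^T *m B t0 *m v = - ((J *m B t0 *m v)^T *m Om *m v)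
      - (J *m B t0 *m v)^T *m Om *m (0 : 'cV_(n + n)).
    rewrite mulmx0 subr0 !trmx_mul Bs // -!mulmxA (mulmxA J^T) J0_tr_Omx.
    by rewrite mulNmx mul1mx !mulmxN opprK.
  have qt := mcvg_tr q0; have cst m p (A : 'M[R]_(m, p)) := @mcvg_cst R _ _ FF m p A.
  by apply: mcvgD; apply: mcvgN; apply: mcvgM => //; apply: mcvgM.
suff -> : (v^T *m B t0 *m v) 0 0 = c by [].
apply: (cvg_unique _ (G0 0 0)); first exact: norm_hausdorff.
apply: cvg_trans wd; apply: near_eq_cvg; near=> t.
have [_ vw] : w t \in mx_img J (ell t0) /\ v + w t \in ell t by near: t.
have ttT : 0 <= t <= T by near: t; exact: pnbhs_bound.
have := isotropic_mx (flow_lagrangian ttT) (uP t v vl) vw.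
have qE : q t = (t - t0)^-1 *: (De t *m v) by rewrite /q /De -!scalemxAl.
rewrite wt0 !omega0E mulmx0 [X in _ *: (_ - X)]mxE subr0 qE.
rewrite [(_ + _)^T]linearD /= !mulmxDl !mulmxDr (isotropic_mx lt vl vl) add0r.
move=> /eqP; rewrite addr_eq0 => /eqP ->.
rewrite linearZ /= -!scalemxAl -scalerN -scalerBr -opprD [in RHS]mxE.
by [].
Unshelve. all: by end_near.
Qed.

End Flow.

(** * Jumps of the positive index *)

Section KashiwaraDerivative.
Variables (R : realType) (n : nat).
Local Notation J := (J0 R n).
Local Notation Om := (Omx R n).
Local Notation kash := (kash Om).
Variables M1 M2 : 'M[R]_(n, n + n).

(** [kash] is affine in its last argument and this is its linear part, so difference quotients of
    [kash] are [dkash] of difference quotients. *)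
Definition dkash (X : 'M[R]_(n, n + n)) : 'M[R]_(n + (n + n)) :=
  block_mx 0 (row_mx 0 (- (M1 *m Om *m X^T))) (col_mx 0 (X *m Om *m M1^T))
    (block_mx 0 (M2 *m Om *m X^T) (- (X *m Om *m M2^T)) 0).

Lemma dkashB X Y : kash M1 M2 X - kash M1 M2 Y = dkash (X - Y).
Proof.
rewrite /dkash /kash; move: (Omx R n) => O.
rewrite !(opp_block_mx, add_block_mx, opp_row_mx, opp_col_mx, add_row_mx, add_col_mx).
rewrite !subrr (linearB _ X Y) /= !mulmxBl !mulmxBr !opprB !opprK.
by congr block_mx; [congr row_mx|congr block_mx]; rewrite addrC.
Qed.

Lemma dkashZ c X : dkash (c *: X) = c *: dkash X.
Proof.
rewrite /dkash !(scale_block_mx, scale_row_mx, scale_col_mx) !scaler0 !scalerN.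
by rewrite [(c *: X)^T]linearZ /= -!scalemxAr -!scalemxAl.
Qed.

Lemma mcvg_dkash (F : set_system R) {FF : Filter F} X X0 :
  mcvg F X X0 -> mcvg F (fun t => dkash (X t)) (dkash X0).
Proof.
move=> hX; have hT := mcvg_tr hX.
have cst m p (A : 'M[R]_(m, p)) := @mcvg_cst R _ _ FF m p A.
have hl (A : 'M[R]_(n, n + n)) :
    mcvg F (fun t => A *m Om *m (X t)^T) (A *m Om *m X0^T) by apply: mcvgM.
have hr (A : 'M[R]_(n, n + n)) :
    mcvg F (fun t => X t *m Om *m A^T) (X0 *m Om *m A^T).
  by apply: mcvgM => //; apply: mcvgM.
apply: mcvg_col; apply: mcvg_row => //.
- by apply: mcvg_row => //; exact: mcvgN.
- exact: mcvg_col.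
- by apply: mcvg_col; apply: mcvg_row => //; exact: mcvgN.
Qed.

Lemma dkash_form m (A B C : 'M[R]_(m, n)) X :
  let K := row_mx A (row_mx B C) in
  K *m dkash X *m K^T =
  (B *m M2 - A *m M1) *m Om *m (C *m X)^T + C *m X *m Om *m (A *m M1 - B *m M2)^T.
Proof.
rewrite /= /dkash; move: (Omx R n) => O.
rewrite mul_row_block mulmx0 add0r mul_row_col mulmx0 add0r mul_mx_row.
rewrite mulmx0 mul_row_block !mulmx0 add0r addr0 add_row_mx add0r.
rewrite !tr_row_mx !mul_row_col !mulmxN (linearB _ (A *m M1)) /= !trmx_mul.
rewrite !(mulmxBl, mulmxBr, mulNmx, mulmxDl, mulmxA).
by apply/matrixP => i j; rewrite !mxE; ring.
Qed.

Variables (X : 'M[R]_(n, n + n)) (Bs : 'M[R]_(n + n)).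
Hypotheses (l1 : lagr_mx Om M1) (l2 : lagr_mx Om M2) (lX : lagr_mx Om X).
Hypothesis (Bsym : Bs^T = Bs).

Definition posdef_on m (V : 'M[R]_(m, n + n)) :=
  forall v : 'rV[R]_(n + n), (v <= V)%MS -> v != 0 -> 0 < (v *m Bs *m v^T) 0 0.

Lemma posdef_on_frame (M : 'M[R]_(n, n + n)) : posdef_on (X :&: M)%MS ->
  exists a b : 'M[R]_(\rank (X :&: M)%MS, n), a *m X = b *m M /\
    2 *: (a *m X *m Bs *m (a *m X)^T) = 1%:M.
Proof.
move=> pos; have [g [b [E [F C]]]] := capmx_frame X M.
pose S := 2 *: (g *m X *m Bs *m (g *m X)^T).
have [||P PS] := @posdef_frame R _ S.
- by rewrite /S linearZ /= form_tr.
- move=> x x0; rewrite /S -scalemxAr -scalemxAl mxE mulr_gt0 ?ltr0n //.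
  have := pos (x *m (g *m X)); rewrite trmx_mul !mulmxA; apply.
    by rewrite -mulmxA; apply: submx_trans (submxMl _ _) _; rewrite C.
  apply: contra x0 => /eqP x0; apply/eqP; apply: (row_free_inj F).
  by rewrite mul0mx mulmxA.
exists (P *m g), (P *m b); rewrite -!mulmxA E; split => //.
rewrite -PS /S -scalemxAr -scalemxAl; congr (_ *: _).
by rewrite -E !trmx_mul !mulmxA.
Qed.

Let iso m (P : 'M[R]_(m, n)) M : lagr_mx Om M -> P *m M *m Om *m M^T = 0.
Proof. by case=> _ MM; rewrite -!mulmxA (mulmxA M) MM mulmx0. Qed.

(** Each term contributes [V B V^T], by [Om J = 1] and [J^T Om = -1]. This is the origin of the
    factor 2 in [posdef_on_frame]. *)
Let skew_form m (V : 'M[R]_(m, n + n)) :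
  V *m Om *m (V *m Bs *m J^T)^T - V *m Bs *m J^T *m Om *m V^T =
  2 *: (V *m Bs *m V^T).
Proof.
rewrite !trmx_mul trmxK Bsym -[V *m Om *m _]mulmxA (mulmxA Om) Omx_J0 mul1mx.
rewrite -[V *m Bs *m J^T *m Om]mulmxA J0_tr_Omx [_ *m (- 1%:M)]mulmxN mulmx1 mulNmx.
by rewrite opprK -mulmxA scaler_nat mulr2n.
Qed.

(** The frame consists of kernel triples [(0, v, v)], normalised for [2 v B v^T]; its companion for
    [M1] uses [(v, 0, v)], where the sign is opposite. *)
Lemma crossing_frame2 : posdef_on (X :&: M2)%MS ->
  exists K : 'M[R]_(\rank (X :&: M2)%MS, n + (n + n)),
    K *m kash M1 M2 X = 0 /\ K *m dkash (X *m Bs *m J^T) *m K^T = 1%:M.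
Proof.
move=> /posdef_on_frame[a [b [E N]]]; exists (row_mx 0 (row_mx b a)); split.
  rewrite mul_kash // mul0mx -E subrr !mul0mx sub0r subr0 iso // E mulNmx mulNmx.
  by rewrite iso // oppr0 !row_mx0.
rewrite -N -skew_form dkash_form mul0mx subr0 sub0r -E.
by rewrite [(- (a *m X))^T]linearN /= [X in _ + X]mulmxN !mulmxA.
Qed.

Lemma crossing_frame1 : posdef_on (X :&: M1)%MS ->
  exists K : 'M[R]_(\rank (X :&: M1)%MS, n + (n + n)),
    K *m kash M1 M2 X = 0 /\ K *m (- dkash (X *m Bs *m J^T)) *m K^T = 1%:M.
Proof.
move=> /posdef_on_frame[a [b [E N]]]; exists (row_mx b (row_mx 0 a)); split.
  rewrite mul_kash // mul0mx -E subrr !mul0mx sub0r subr0 E iso // -E !mulNmx.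
  by rewrite iso // oppr0 !row_mx0.
rewrite -N -skew_form [K in K *m _ = _]mulmxN mulNmx dkash_form mul0mx subr0 sub0r -E.
by rewrite opprD [- (a *m X) *m _]mulNmx mulNmx opprK !mulmxA.
Qed.

End KashiwaraDerivative.

(** * The jump at a single instant *)

Section LocalJump.
Variables (R : realType) (n : nat).
Local Notation Om := (Omx R n).
Local Notation kash := (kash Om).
Variables M1 M2 : 'M[R]_(n, n + n).
Hypotheses (l1 : lagr_mx Om M1) (l2 : lagr_mx Om M2).

(** [h] is the distance to the instant and [D] the velocity seen from one side, so one argument
    serves both sides. [K] adds [a] positive and [K'] adds [b] negative directions. *)
Lemma one_sided_jump (F : set_system R) {FF : Filter F} (h : R -> R)
    (X : R -> 'M[R]_(n, n + n)) X0 D a b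
    (K : 'M[R]_(a, n + (n + n))) (K' : 'M[R]_(b, n + (n + n))) :
  (\forall t \near F, 0 < h t) -> h @ F --> (0 : R) ->
  lagr_mx Om X0 -> (\forall t \near F, lagr_mx Om (X t)) ->
  mcvg F (fun t => (h t)^-1 *: (X t - X0)) D ->
  K *m kash M1 M2 X0 = 0 -> K *m dkash M1 M2 D *m K^T = 1%:M ->
  K' *m kash M1 M2 X0 = 0 -> K' *m (- dkash M1 M2 D) *m K'^T = 1%:M ->
  (a + b = \rank (X0 :&: M1)%MS + \rank (X0 :&: M2)%MS)%N ->
  \forall t \near F, [/\ \rank (X t :&: M1)%MS = 0%N, \rank (X t :&: M2)%MS = 0%N
    & posix (kash M1 M2 (X t)) = posix (kash M1 M2 X0) + a]%N.
Proof.
move=> hp h0 lX0 lX hD K0 KD K'0 K'D ab.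
have ks (Y : 'M[R]_(n, n + n)) : (kash M1 M2 Y)^T = kash M1 M2 Y.
  by apply: kash_sym; exact: Omx_tr.
have nks (Y : 'M[R]_(n, n + n)) : (- kash M1 M2 Y)^T = - kash M1 M2 Y by rewrite raddfN /= ks.
have [P PP] := posixP (kash M1 M2 X0).
have [P' PP'] := posixP (- kash M1 M2 X0).
have c1 : mcvg F (fun t => (h t)^-1 *: (kash M1 M2 (X t) - kash M1 M2 X0))
    (dkash M1 M2 D).
  under eq_fun do rewrite dkashB -dkashZ.
  exact: mcvg_dkash.
have c2 : mcvg F (fun t => (h t)^-1 *: (- kash M1 M2 (X t) - - kash M1 M2 X0))
    (- dkash M1 M2 D).
  under eq_fun do rewrite -opprD scalerN.
  exact: mcvgN.
have n1 : \forall t \near F, has_pos (kash M1 M2 (X t)) (posix (kash M1 M2 X0) + a)%N.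
  apply: (@perturbed_frame _ _ F FF _ _ _ h (fun t => kash M1 M2 (X t)) _ _ P K
    hp h0 (ks _) _ c1 PP K0 KD).
  by near=> t.
have n2 : \forall t \near F,
    has_pos (- kash M1 M2 (X t)) (posix (- kash M1 M2 X0) + b)%N.
  apply: (@perturbed_frame _ _ F FF _ _ _ h (fun t => - kash M1 M2 (X t)) _ _ P' K'
    hp h0 (nks _) _ c2 PP' _ K'D); first by near=> t.
  by rewrite mulmxN K'0 oppr0.
near=> t.
have lt : lagr_mx Om (X t) by near: t.
have /posix_geq p1 : has_pos (kash M1 M2 (X t)) (posix (kash M1 M2 X0) + a)%N by near: t.
have /posix_geq p2 : has_pos (- kash M1 M2 (X t)) (posix (- kash M1 M2 X0) + b)%N.
  by near: t.
(* Since [a + b] is the rank lost at [X0], the two lower bounds add up to the largest rank possible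
   at [t], which turns them into equalities. *)
have := rank_kash_geq (Omx_unit R n) l1 l2 lX0.
have := rank_kash_leq (Omx_unit R n) l1 l2 lt.
rewrite -(posix_rank (ks X0)) -(posix_rank (ks (X t))).
move: ab p1 p2; move: (posix (kash M1 M2 (X t))) (posix (- kash M1 M2 (X t))).
move: (posix (kash M1 M2 X0)) (posix (- kash M1 M2 X0)).
move: (\rank (X0 :&: M1)%MS) (\rank (X0 :&: M2)%MS) (\rank (M1 :&: M2)%MS).
move: (\rank (X t :&: M1)%MS) (\rank (X t :&: M2)%MS) => x1 x2 y1 y2 d q1 q2 q3 q4.
by split; lia.
Unshelve. all: by end_near.
Qed.

Variable T : R.

Lemma local_jump (X : R -> 'M[R]_(n, n + n)) (Bs : 'M[R]_(n + n)) t0 :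
  0 <= t0 <= T -> (forall t, 0 <= t <= T -> lagr_mx Om (X t)) -> Bs^T = Bs ->
  mderiv T X t0 (X t0 *m Bs *m (J0 R n)^T) ->
  posdef_on Bs (X t0 :&: M1)%MS -> posdef_on Bs (X t0 :&: M2)%MS ->
  exists2 e, 0 < e & forall t, 0 <= t <= T -> `|t - t0| < e ->
    jump_law (fun t => \rank (X t :&: M1)%MS) (fun t => \rank (X t :&: M2)%MS)
      (fun t => posix (kash M1 M2 (X t))) t0 t.
Proof.
move=> t0T lX Bsym X' pos1 pos2.
have lX0 := lX _ t0T.
have [K1 [K1k K1d]] := crossing_frame1 M2 l1 lX0 Bsym pos1.
have [K2 [K2k K2d]] := crossing_frame2 M1 l2 lX0 Bsym pos2.
set D := X t0 *m Bs *m (J0 R n)^T in X' K1d K2d.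
have sided (S : set R) : within S (pnbhs T t0) `=>` pnbhs T t0 by exact: cvg_within.
pose Fr := within [set t | t0 < t] (pnbhs T t0).
pose Fl := within [set t | t < t0] (pnbhs T t0).
have lagrF : \forall t \near pnbhs T t0, lagr_mx Om (X t).
  by apply: filterS (pnbhs_bound T t0) => t; exact: lX.
have FFr : Filter Fr by exact: within_filter.
have FFl : Filter Fl by exact: within_filter.
have nr : \forall t \near Fr,
    [/\ \rank (X t :&: M1)%MS = 0%N, \rank (X t :&: M2)%MS = 0%N
    & posix (kash M1 M2 (X t)) = posix (kash M1 M2 (X t0)) + \rank (X t0 :&: M2)%MS]%N.
  apply: (@one_sided_jump Fr FFr (fun t => t - t0) _ _ D _ _ K2 K1) => //.
  - by rewrite near_withinE; near=> t => /=; rewrite subr_gt0.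
  - by apply: cvg_trans (pnbhs_cvg T t0); apply: cvg_app; exact: sided.
  - by apply: sided.
  - by move=> i j; apply: cvg_trans (X' i j); apply: cvg_app; exact: sided.
  - by rewrite addnC.
have nl : \forall t \near Fl,
    [/\ \rank (X t :&: M1)%MS = 0%N, \rank (X t :&: M2)%MS = 0%N
    & posix (kash M1 M2 (X t)) = posix (kash M1 M2 (X t0)) + \rank (X t0 :&: M1)%MS]%N.
  (* Seen from the left the velocity is [- D], so [K1] and [K2] exchange their roles. *)
  have dN : dkash M1 M2 (- D) = - dkash M1 M2 D by rewrite -scaleN1r dkashZ scaleN1r.
  apply: (@one_sided_jump Fl FFl (fun t => t0 - t) _ _ (- D) _ _ K1 K2) => //.
  - by rewrite near_withinE; near=> t => /=; rewrite subr_gt0.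
  - rewrite -oppr0; under eq_fun do rewrite -opprB.
    by apply: cvgN; apply: cvg_trans (pnbhs_cvg T t0); apply: cvg_app; exact: sided.
  - by apply: sided.
  - under eq_fun do rewrite -opprB invrN scaleNr.
    apply: mcvgN => i j; apply: cvg_trans (X' i j); apply: cvg_app; exact: sided.
  - by rewrite dN.
  - by rewrite dN opprK.
move: nr nl; rewrite !near_withinE => /near_pnbhsP[e1 e10 h1] /near_pnbhsP[e2 e20 h2].
exists (Num.min e1 e2); first by rewrite lt_min e10.
move=> t tT; rewrite lt_min => /andP[te1 te2]; split => tt0.
  by apply: h1 => //; rewrite gt_eqF.
by apply: h2 => //; rewrite lt_eqF.
Unshelve. all: by end_near.
Qed.

End LocalJump.

(** * From the jump count to the inequality *)

Lemma nu_finite (R : realType) (n : nat) (T : R) (ell : R -> {vspace 'cV[R]_(n + n)})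
    (L0 : {vspace 'cV[R]_(n + n)}) (s : seq R) (x : R -> nat) :
  uniq s -> (forall t, t \in s -> 0 <= t <= T) ->
  (forall t, 0 <= t <= T -> t \notin s -> x t = 0%N) ->
  (forall t, \dim (ell t :&: L0) = x t) ->
  nu T ell L0 = (\sum_(t <- s) x t)%:Z.
Proof.
move=> us sT s0 dx; rewrite /nu -(@fsbig_widen _ _ _ _ [set` s]).
- rewrite -fsbig_seq // (big_morph Posz PoszD (erefl _)).
  by apply: eq_bigr => t _; rewrite dx.
- by move=> t /sT /=; rewrite in_itv.
- move=> t [/=]; rewrite in_itv /= => tT /negP ts.
  by rewrite dx s0.
Qed.

(** Grassmann's formula: the two summands meet in the triple intersection. *)
Lemma dim_delta (R : realType) N (L L1 L2 : {vspace 'cV[R]_N}) m m1 m2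
    (M : 'M[R]_(m, N)) (M1 : 'M[R]_(m1, N)) (M2 : 'M[R]_(m2, N)) :
  spans L M -> spans L1 M1 -> spans L2 M2 ->
  (\dim (L :&: L1 + L1 :&: L2) + \rank (M1 :&: M2 :&: M)%MS =
    \rank (M :&: M1)%MS + \rank (M1 :&: M2)%MS)%N.
Proof.
move=> LM LM1 LM2.
rewrite -(spans_dim (spans_cap LM LM1)) -(spans_dim (spans_cap LM1 LM2)).
rewrite -dimv_sum_cap; congr (_ + _)%N.
rewrite -(spans_dim (spans_cap (spans_cap LM1 LM2) LM)).
congr (\dim _); apply/vspaceP => v; rewrite !memv_cap.
by case: (v \in L); case: (v \in L1); case: (v \in L2).
Qed.

(** [A] and [Z] are the initial and the final Lagrangian. A positive index is bounded below by
    [kash_isotropic], and above by the rank minus the lower bound for the negative index;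
    [kash_difference], used in both orders, treats the two ends together. *)
Lemma count_bounds (R : realType) (n : nat) (M1 M2 A Z : 'M[R]_(n, n + n)) (N1 N2 : nat) :
  let Om := Omx R n in
  lagr_mx Om M1 -> lagr_mx Om M2 -> lagr_mx Om A -> lagr_mx Om Z ->
  (posix (kash Om M1 M2 Z) + \rank (Z :&: M2)%MS + N1 =
    posix (kash Om M1 M2 A) + \rank (A :&: M1)%MS + N2)%N ->
  [/\ (N2 + \rank (A :&: M1)%MS + \rank (M1 :&: M2)%MS
        <= n + N1 + \rank (M1 :&: M2 :&: A)%MS)%N,
      (N1 + \rank (Z :&: M2)%MS + \rank (M1 :&: M2)%MS
        <= n + N2 + \rank (M1 :&: M2 :&: Z)%MS)%N,
      (N2 + \rank (A :&: Z)%MS <= n + N1 + \rank (A :&: Z :&: M2)%MS)%N &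
      (N1 + \rank (A :&: Z)%MS <= n + N2 + \rank (A :&: Z :&: M1)%MS)%N].
Proof.
move=> Om l1 l2 lA lZ.
have Omt : Om^T = - Om := Omx_tr R n; have Omu : Om \in unitmx := Omx_unit R n.
have := rank_kash_leq Omu l1 l2 lA; have := rank_kash_geq Omu l1 l2 lA.
have := rank_kash_leq Omu l1 l2 lZ; have := rank_kash_geq Omu l1 l2 lZ.
rewrite -!(posix_rank (kash_sym Omt M1 M2 _)).
have [] := kash_isotropic Omt Omu l1 l2 lA; have [] := kash_isotropic Omt Omu l1 l2 lZ.
have := kash_difference Omt Omu l1 l2 lA lZ; have := kash_difference Omt Omu l1 l2 lZ lA.
rewrite (capmxC Z A).
(* Each of the four bounds leaves one surplus intersection, which one of these inclusions
   absorbs. *)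
have : (\rank (M1 :&: M2 :&: A)%MS <= \rank (A :&: M2)%MS)%N.
  by apply: mxrankS; rewrite capmxC capmxS ?capmxSr.
have : (\rank (M1 :&: M2 :&: Z)%MS <= \rank (Z :&: M1)%MS)%N.
  by apply: mxrankS; rewrite capmxC capmxS ?capmxSl.
have : (\rank (A :&: Z :&: M1)%MS <= \rank (A :&: M1)%MS)%N.
  by apply: mxrankS; rewrite capmxS ?capmxSl.
have : (\rank (A :&: Z :&: M2)%MS <= \rank (A :&: M2)%MS)%N.
  by apply: mxrankS; rewrite capmxS ?capmxSl.
move: (posix (kash Om M1 M2 A)) (posix (- kash Om M1 M2 A)).
move: (posix (kash Om M1 M2 Z)) (posix (- kash Om M1 M2 Z)) => pZ mZ pA mA.
move: (\rank (M1 :&: M2 :&: A)%MS) (\rank (M1 :&: M2 :&: Z)%MS) => cA cZ.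
move: (\rank (A :&: Z :&: M1)%MS) (\rank (A :&: Z :&: M2)%MS) => c1 c2.
move: (\rank (A :&: M1)%MS) (\rank (A :&: M2)%MS) => a1 a2.
move: (\rank (Z :&: M1)%MS) (\rank (Z :&: M2)%MS) => z1 z2.
move: (\rank (A :&: Z)%MS) (\rank (M1 :&: M2)%MS) => e d.
by move=> *; split; lia.
Qed.

Theorem theorem3p12 (R : realType) (n : nat) (T : R)
  (B : R -> 'M[R]_(n + n)) (psi : R -> 'M[R]_(n + n))
  (L L1 L2 : {vspace 'cV[R]_(n + n)}) :
  0 < T ->
  {within `[0, T], continuous B} ->
  (forall t, 0 <= t <= T -> (B t)^T = B t) ->
  psi 0 = 1%:M ->
  (forall t, 0 <= t <= T -> deriv_within 0 T psi t (J0 R n *m B t *m psi t)) ->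
  lagrangian L -> lagrangian L1 -> lagrangian L2 ->
  let ell := fun t => mx_img (psi t) L in
  plus_curve T ell L1 -> plus_curve T ell L2 ->
  let e1 := (\dim (L :&: ell T) - \dim (L :&: ell T :&: L1))%N in
  let e2 := (\dim (L :&: ell T) - \dim (L :&: ell T :&: L2))%N in
  let delta1 := (L :&: L1 + L1 :&: L2)%VS in
  let delta2 := (ell T :&: L2 + L1 :&: L2)%VS in
  let k1 := minn e1 e2 in
  let k2 := minn (\dim delta1) (\dim delta2) in
  let k := maxn k1 k2 in
  `|nu T ell L2 - nu T ell L1| <= n%:Z - k%:Z.
Proof.
move=> T0 _ Bs psi0 psi'_within lL lL1 lL2 ell plus1 plus2; cbv zeta.
have psi' t : 0 <= t <= T -> mderiv T psi t (J0 R n *m B t *m psi t).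
  by move=> tT; apply: deriv_within_mderiv; exact: psi'_within.
have [M lM LM] := lagrangian_frame lL.
have [M1 lM1 LM1] := lagrangian_frame lL1.
have [M2 lM2 LM2] := lagrangian_frame lL2.
pose X t := M *m (psi t)^T.
have lX t : 0 <= t <= T -> lagr_mx (Omx R n) (X t).
  by move=> tT; exact: (flow_frame Bs psi0 psi' tT lM).
have sX t : spans (ell t) (X t) by exact: flow_spans.
have X0 : X 0 = M by rewrite /X psi0 trmx1 mulmx1.
have pos L0 (M0 : 'M[R]_(n, n + n)) : spans L0 M0 -> plus_curve T ell L0 ->
    forall t, 0 <= t <= T -> posdef_on (B t) (X t :&: M0)%MS.
  move=> LM0 plus t tT v; rewrite sub_capmx => /andP[vX vM0] v0.
  have := plus_curve_posdef T0 Bs psi0 psi' lM LM plus tT (v := v^T).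
  rewrite sX LM0 trmxK; apply => //.
  by apply: contra v0 => /eqP/(congr1 trmx); rewrite trmxK trmx0 => ->.
have X't t : 0 <= t <= T -> mderiv T X t (X t *m B t *m (J0 R n)^T).
  move=> tT; have := mderivM (mderiv_cst T M t) (mderiv_tr (psi' t tT)).
  by rewrite mul0mx add0r !trmx_mul Bs // !mulmxA.
have [|s [us sT sx sp]] := jump_counting (T := T)
    (x1 := fun t => \rank (X t :&: M1)%MS) (x2 := fun t => \rank (X t :&: M2)%MS)
    (p := fun t => posix (kash (Omx R n) M1 M2 (X t))) T0.
  move=> t tT; apply: (local_jump lM1 lM2 tT lX (Bs t tT) (X't t tT)).
    exact: (pos L1 M1).
  exact: (pos L2 M2).
have nu1 : nu T ell L1 = (\sum_(t <- s) \rank (X t :&: M1)%MS)%:Z.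
  apply: nu_finite us sT _ _ => [t tT ts|t]; first by have [] := sx t tT ts.
  exact: spans_dim (spans_cap (sX t) LM1).
have nu2 : nu T ell L2 = (\sum_(t <- s) \rank (X t :&: M2)%MS)%:Z.
  apply: nu_finite us sT _ _ => [t tT ts|t]; first by have [] := sx t tT ts.
  exact: spans_dim (spans_cap (sX t) LM2).
have lZ : lagr_mx (Omx R n) (X T) by apply: lX; rewrite lexx ltW.
rewrite X0 in sp; rewrite nu1 nu2.
have [b1 b2 b3 b4] := count_bounds lM1 lM2 lM lZ sp.
move: b1 b2 b3 b4; move: (\sum_(t <- s) _)%N (\sum_(t <- s) _)%N => N1 N2 b1 b2 b3 b4.
have sZ := sX T.
rewrite (spans_dim (spans_cap LM sZ)) (spans_dim (spans_cap (spans_cap LM sZ) LM1)).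
rewrite (spans_dim (spans_cap (spans_cap LM sZ) LM2)).
have d1 := dim_delta LM LM1 LM2.
have := dim_delta sZ LM2 LM1; rewrite (capvC L2 L1) (capmxC M2 M1) => d2.
move: (\dim (L :&: L1 + L1 :&: L2)) (\dim (ell T :&: L2 + L1 :&: L2)) d1 d2 => D1 D2 d1 d2.
(* [b1] and [b3] bound [N2 - N1] by [n - D1] and by [n] minus the second [e]; [b2] and [b4] bound
   [N1 - N2] by [n - D2] and by [n] minus the first. *)
rewrite ler_norml; apply/andP; split; lia.
Qed.
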